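(* Let $T\ge1$ be an integer and run the randomized incremental proximal method from a deterministic $x_0\in\mathbb{R}^n$ with step size $\tau=\frac{1}{5L\sqrt{T}}$: \[ x_{t+1}=\operatorname{prox}_{\tau m g_{j_t}}\bigl(x_t-\tau\nabla f_{i_t}(x_t)\bigr),\quad t=0,\dots,T. \] Then \[ \mathbb{E}\left[h(x_{T+1})-h^*\right]\le\frac{10}{\sqrt{T}}\left[LD_*^2+\frac{1}{\sqrt{T}}\bigl(h(x_0)-h^*\bigr)+\frac{\sigma_*^2+4m^2L_g^2}{L}\Bigl(\frac1T+4\ln(T+1)\Bigr)\right]. \]
   Context: Setting. Let $D$ be a probability distribution on an index set, and for each index $i$ let $f_i:\mathbb{R}^n\to\mathbb{R}$ be convex and differentiable with $L$-Lipschitz gradient ($L>0$). Let $f(x)=\mathbb{E}_{i\sim D}[f_i(x)]$ with $\mathbb{E}_{i\sim D}[\nabla f_i(x)]=\nabla f(x)$ for all $x$. Let $g=\sum_{j=1}^m g_j$ where each $g_j:\mathbb{R}^n\to\mathbb{R}$ is proper, convex, lower semicontinuous and $L_g$-Lipschitz ($|g_j(x)-g_j(y)|\le L_g\|x-y\|$). Let $h=f+g$, assume $X^*=\arg\min h$ is nonempty, $h^*=\min h$, $D_*^2=\min_{x^*\in X^*}\|x^*-x_0\|^2$, and $\sigma_*^2:=\mathbb{E}_{i\sim D}\|\nabla f_i(x^* )\|^2<\infty$ for some $x^*\in X^*$. For $\lambda>0$, $\operatorname{prox}_{\lambda \phi}(y)=\arg\min_z\{\lambda\phi(z)+\tfrac12\|y-z\|^2\}$.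 At each iteration $i_t$ is drawn from $D$ and $j_t$ uniformly from $\{1,\dots,m\}$, independently of each other and of $x_0,\dots,x_t$ (i.i.d. across iterations). *)

(* Defs.v *)
From HB Require Import structures.
From mathcomp Require Import all_boot all_order all_algebra.
From mathcomp Require Import all_classical all_reals all_analysis.
Set Implicit Arguments. Unset Strict Implicit. Unset Printing Implicit Defensive.
Import Order.TTheory GRing.Theory Num.Theory.
Local Open Scope ring_scope.
Local Open Scope classical_set_scope.

(* Vectors of R^n are row vectors 'rV[R]_n; the Euclidean structure is
   defined explicitly (the canonical norm on 'rV is the max-norm). *)
Definition dotv (R : realType) (n : nat) (u v : 'rV[R]_n) : R :=
  \sum_(k < n) u ord0 k * v ord0 k.

Definition enorm (R : realType) (n : nat) (u : 'rV[R]_n) : R :=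
  Num.sqrt (dotv u u).

Definition convex_fun (R : realType) (n : nat) (phi : 'rV[R]_n -> R) : Prop :=
  forall (x y : 'rV[R]_n) (t : R), 0 <= t -> t <= 1 ->
    phi (t *: x + (1 - t) *: y) <= t * phi x + (1 - t) * phi y.

Definition is_prox (R : realType) (n : nat) (lam : R) (phi : 'rV[R]_n -> R)
  (y z : 'rV[R]_n) : Prop :=
  forall w : 'rV[R]_n,
    lam * phi z + 2^-1 * enorm (y - z) ^+ 2 <= lam * phi w + 2^-1 * enorm (y - w) ^+ 2.

(* prox_{lam phi}(y): the (unique, for convex continuous phi and lam > 0)
   minimizer, selected by choice. *)
Definition prox (R : realType) (n : nat) (lam : R) (phi : 'rV[R]_n -> R)
  (y : 'rV[R]_n) : 'rV[R]_n :=
  xget y [set z | is_prox lam phi y z].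

Definition rip_step (R : realType) (n m : nat) (I : Type)
  (gf : I -> 'rV[R]_n -> 'rV[R]_n) (g : 'I_m -> 'rV[R]_n -> R) (tau : R)
  (i : I) (j : 'I_m) (x : 'rV[R]_n) : 'rV[R]_n :=
  prox (tau * m%:R) (g j) (x - tau *: gf i x).

(* exp_gap k x = E[ h(x_k) - hstar ] where x_0 = x and k steps of the method
   are run with i_t ~ D and j_t ~ Unif('I_m) all independent (i.i.d.).
   By independence the expectation over the k-fold product is the iterated
   expectation below (nonnegative extended-real integrands). *)
Fixpoint exp_gap (R : realType) (n m : nat) (d : measure_display)
  (I : measurableType d) (D : probability I R)
  (gf : I -> 'rV[R]_n -> 'rV[R]_n) (g : 'I_m -> 'rV[R]_n -> R) (tau : R)
  (h : 'rV[R]_n -> R) (hstar : R) (k : nat) (x : 'rV[R]_n) : \bar R :=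
  match k with
  | 0 => ((h x - hstar)%:E)
  | k'.+1 => (\int[D]_i ((m%:R^-1)%:E *
       \sum_(j < m) exp_gap D gf g tau h hstar k' (rip_step gf g tau i j x)))%E
  end.

(* Main.v *)
Require Import Defs.
From HB Require Import structures.
From mathcomp Require Import all_boot all_order all_algebra.
From mathcomp Require Import all_classical all_reals all_analysis.
From mathcomp Require Import measurable_realfun.
From mathcomp Require Import ring lra.
Import Order.TTheory GRing.Theory Num.Theory.
Import numFieldNormedType.Exports.
Set Implicit Arguments.
Unset Strict Implicit.
Unset Printing Implicit Defensive.
Local Open Scope ring_scope.
Local Open Scope classical_set_scope.

(* Write K for the transition operator of the method, so that exp_gap k is K^k
   applied to gap = h - h*.  The prox inequality, the convexity of the f_i and
   the Lipschitz bound on the g_j give, for every z,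
     K(|. - z|^2 / 2)(x) <= |x - z|^2 / 2 - tau (gap x - gap z)
                            + tau (eps gap x + tau C),
   with eps = (5/4) L tau and C = 5 (m^2 Lg^2 + sig2).  The multiplicative term
   eps gap x arises because cocoercivity of the gradients and first-order
   optimality at xs bound E|grad f_i(x) - grad f_i(xs)|^2 by 2 L gap x.
   Iterating with z = x and then applying K^(N-k) compares the average of the
   last k + 1 expected gaps with the gap at time N - k; iterating with z the
   projection of x0 on the minimizers bounds the average of all of them.  Going
   down from the full average to the last term costs a factor
   1 / (1 - eps H_N) <= 2, since the harmonic number H_(T+1) is at most
   2 sqrt T, and an additive tau C H_N, which is the source of the logarithm. *)

(** * The Euclidean inner product and norm on row vectors *)

Section Euclidean.
Context {R : realType} {n : nat}.
Implicit Types (u v w x y z : 'rV[R]_n) (a b : R).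

Lemma dotvC u v : dotv u v = dotv v u.
Proof. by rewrite /dotv; apply: eq_bigr => k _; rewrite mulrC. Qed.

Lemma dotvDl u v w : dotv (u + v) w = dotv u w + dotv v w.
Proof. by rewrite /dotv -big_split; apply: eq_bigr => k _; rewrite mxE mulrDl. Qed.

Lemma dotvZl a u v : dotv (a *: u) v = a * dotv u v.
Proof. by rewrite /dotv mulr_sumr; apply: eq_bigr => k _; rewrite mxE mulrA. Qed.

Lemma dotvNl u v : dotv (- u) v = - dotv u v.
Proof. by rewrite -scaleN1r dotvZl mulN1r. Qed.

Lemma dotvDr u v w : dotv u (v + w) = dotv u v + dotv u w.
Proof. by rewrite dotvC dotvDl !(dotvC u). Qed.

Lemma dotvZr a u v : dotv u (a *: v) = a * dotv u v.
Proof. by rewrite dotvC dotvZl dotvC. Qed.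

Lemma dotvNr u v : dotv u (- v) = - dotv u v.
Proof. by rewrite dotvC dotvNl dotvC. Qed.

Definition dotvE := (dotvDl, dotvDr, dotvNl, dotvNr, dotvZl, dotvZr).

Lemma dotv0 u : dotv u 0 = 0.
Proof. by rewrite -(scale0r u) dotvZr mul0r. Qed.

Lemma dotvv_ge0 u : 0 <= dotv u u.
Proof. by apply: sumr_ge0 => k _; rewrite -expr2 sqr_ge0. Qed.

Lemma enorm_ge0 u : 0 <= enorm u.
Proof. exact: sqrtr_ge0. Qed.

Lemma enorm_sqr u : enorm u ^+ 2 = dotv u u.
Proof. by rewrite sqr_sqrtr // dotvv_ge0. Qed.

Lemma enorm0 : enorm (0 : 'rV[R]_n) = 0.
Proof. by rewrite /enorm dotv0 sqrtr0. Qed.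

Lemma enormZ a u : enorm (a *: u) = `|a| * enorm u.
Proof. by rewrite /enorm !dotvE mulrA -expr2 sqrtrM ?sqr_ge0 // sqrtr_sqr. Qed.

Lemma enormN u : enorm (- u) = enorm u.
Proof. by rewrite /enorm !dotvE opprK. Qed.

Lemma enormB u v : enorm (u - v) = enorm (v - u).
Proof. by rewrite -enormN opprB. Qed.

(** Cauchy-Schwarz: the squared norm of [enorm v *: u - enorm u *: v] is [2 s t (s t - p)]. Dividing
    by [2 s t] needs both norms positive, so vanishing norms are treated first. *)
Lemma dotv_le_enorm u v : dotv u v <= enorm u * enorm v.
Proof.
have [u0|u0] := eqVneq (enorm u) 0.
  have : dotv u u = 0 by rewrite -enorm_sqr u0 expr0n.
  move=> /eqP; rewrite psumr_eq0 => [/allP u_eq0|k _]; last first.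
    by rewrite -expr2 sqr_ge0.
  rewrite u0 mul0r /dotv big1// => k _.
  have := u_eq0 k (mem_index_enum k); rewrite /= mulf_eq0 orbb => /eqP ->.
  by rewrite mul0r.
have u_gt0 : 0 < enorm u by rewrite lt_def u0 enorm_ge0.
have [v0|v0] := ltP 0 (enorm v); last first.
  have {v0}ve : enorm v = 0 by apply/eqP; rewrite eq_le v0 enorm_ge0.
  have : dotv v v = 0 by rewrite -enorm_sqr ve expr0n.
  move=> /eqP; rewrite psumr_eq0 => [/allP v_eq0|k _]; last first.
    by rewrite -expr2 sqr_ge0.
  rewrite ve mulr0 /dotv big1// => k _.
  have := v_eq0 k (mem_index_enum k); rewrite /= mulf_eq0 orbb => /eqP ->.
  by rewrite mulr0.
have := dotvv_ge0 (enorm v *: u - enorm u *: v).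
rewrite !dotvE -!enorm_sqr (dotvC v u).
set s := enorm u in u_gt0 *; set t := enorm v in v0 *; set p := dotv u v => H.
have {}H : 0 <= (2 * s * t) * (s * t - p).
  by apply: le_trans H _; rewrite le_eqVlt; apply/orP; left; apply/eqP; ring.
by rewrite -subr_ge0 -(pmulr_rge0 _ (_ : 0 < 2 * s * t)) // !mulr_gt0.
Qed.

Lemma enormD u v : enorm (u + v) <= enorm u + enorm v.
Proof.
rewrite -(ler_pXn2r (ltn0Sn 1)) ?nnegrE ?addr_ge0 ?enorm_ge0 // enorm_sqr !dotvE.
have := dotv_le_enorm u v; rewrite (dotvC v u) -!enorm_sqr; nra.
Qed.

Lemma enorm_triangle z u v : enorm (u - v) <= enorm (u - z) + enorm (z - v).
Proof. by rewrite (_ : u - v = (u - z) + (z - v)) ?enormD // subrKA. Qed.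

Lemma enorm_sum_le u : enorm u <= \sum_k `|u ord0 k|.
Proof.
have s0 : 0 <= \sum_k `|u ord0 k| by apply: sumr_ge0.
rewrite -(ler_pXn2r (ltn0Sn 1)) ?nnegrE ?enorm_ge0 // enorm_sqr.
rewrite expr2 mulr_suml /dotv; apply: ler_sum => k _.
rewrite -[u ord0 k * _]ger0_norm -?expr2 ?sqr_ge0 // normrX expr2.
by apply: ler_wpM2l => //; rewrite (bigD1 k) //= lerDl sumr_ge0.
Qed.

Lemma coord_le_enorm u k : `|u ord0 k| <= enorm u.
Proof.
rewrite -(ler_pXn2r (ltn0Sn 1)) ?nnegrE ?enorm_ge0 // enorm_sqr.
rewrite real_normK ?num_real // /dotv (bigD1 k) //= expr2 lerDl.
by apply: sumr_ge0 => l _; rewrite -expr2 sqr_ge0.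
Qed.

(** Links the Euclidean norm to the max-norm, which defines the topology of ['rV[R]_n]. *)
Lemma enorm_le_mx_norm u : enorm u <= n%:R * `|u|.
Proof.
apply: le_trans (enorm_sum_le u) _.
apply: (@le_trans _ _ (\sum_(k < n) `|u|)); last first.
  by rewrite sumr_const card_ord mulr_natl.
apply: ler_sum => k _; rewrite [leRHS]mx_normrE.
exact: (le_bigmax _ (fun ij => `|u ij.1 ij.2|) (ord0, k)).
Qed.

End Euclidean.

(** If [a > 0], then [t = 1] forces [b > 0], and [t = min(1, a / (2 b))] gives a contradiction. This
    replaces the limit [t -> 0] when a minimizer is perturbed along a segment. *)
Lemma le_of_forall_small_linear {R : realType} (a b : R) :
  (forall t, 0 < t -> t <= 1 -> a <= t * b) -> a <= 0.
Proof.
move=> H; rewrite leNgt; apply/negP => a0.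
have b0 : 0 < b by have := H 1 ltr01 (lexx _); lra.
have ab : 0 < a / (2 * b) by rewrite divr_gt0 // mulr_gt0.
have [ab1|ab1] := leP (a / (2 * b)) 1.
  have := H _ ab ab1.
  have -> : a / (2 * b) * b = a / 2 by field; rewrite gt_eqF.
  lra.
have := H 1 ltr01 (lexx _); move: ab1.
rewrite ltr_pdivlMr ?mulr_gt0 // mul1r; lra.
Qed.

(** * Convex functions with Lipschitz gradient *)

Section SmoothConvex.
Context {R : realType} {n : nat}.
Implicit Types x y v : 'rV[R]_n.
Variables (phi : 'rV[R]_n -> R) (dphi : 'rV[R]_n -> 'rV[R]_n).
Hypothesis phi_convex : convex_fun phi.
Hypothesis phi_grad : forall x, differentiable phi x /\
  forall v, 'd phi x v = dotv (dphi x) v.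

(** Convexity bounds each difference quotient in direction [y - x], for [0 < t <= 1], by
    [phi y - phi x]. Only positive [t] are controlled, so the derivative is read as a right
    limit. *)
Lemma convex_ge_tangent x y : phi x + dotv (dphi x) (y - x) <= phi y.
Proof.
have [dif dE] := phi_grad x.
rewrite addrC -lerBrDr -dE -(deriveE _ dif) /derive.
set F := (X in lim (X @ _)).
have cF : cvg (F @ 0^') by exact: diff_derivable.
rewrite (cvg_at_rightE _ _ cF).
apply: limr_le; first exact: cvgP (cvg_dnbhs_at_right cF).
near=> t.
have t0 : 0 < t by near: t; exact: nbhs_right_gt.
have t1 : t <= 1 by near: t; exact: nbhs_right_le.
rewrite /F /= [_ *: _]mulrC ler_pdivrMr //.
have := phi_convex y x (ltW t0) t1.
rewrite (_ : t *: y + _ = t *: (y - x) + x); last first.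
  by rewrite scalerBl scale1r scalerBr addrA addrAC.
lra.
Unshelve. all: by end_near.
Qed.

Variable L : R.
Hypothesis L_gt0 : 0 < L.
Hypothesis dphi_lip : forall x y, enorm (dphi x - dphi y) <= L * enorm (x - y).

(* Bounding each of the N increments along the segment by the slope at its far
   end gives the quadratic upper bound up to the factor (N + 1) / N. *)
Lemma quadratic_upper_subdivision x v (N k : nat) : (0 < N)%N ->
  phi (x + (k%:R / N%:R) *: v) <= phi x + k%:R / N%:R * dotv (dphi x) v
    + L * enorm v ^+ 2 * (k%:R * (k%:R + 1)) / (2 * N%:R ^+ 2).
Proof.
move=> N0; have N0' : 0 < N%:R :> R by rewrite ltr0n.
have NN : N%:R != 0 :> R by rewrite gt_eqF.
elim: k => [|k IHk]; first by rewrite !mul0r scale0r !addr0 mulr0 mul0r addr0.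
set y := x + (k.+1%:R / N%:R) *: v.
have := convex_ge_tangent y (x + (k%:R / N%:R) *: v).
rewrite (_ : x + _ - y = - (N%:R^-1 *: v)); last first.
  rewrite /y opprD addrACA subrr add0r -scalerBl -[RHS]scaleNr.
  by rewrite -natr1; congr (_ *: _); field.
rewrite !dotvE => H.
have := dotv_le_enorm (dphi y - dphi x) v; rewrite dotvDl dotvNl => H1.
have H2 : enorm (dphi y - dphi x) <= L * (k.+1%:R / N%:R * enorm v).
  by have := dphi_lip y x; rewrite /y addrAC subrr add0r enormZ ger0_norm.
have {}H1 : dotv (dphi y) v <= dotv (dphi x) v + L * (k.+1%:R / N%:R) * enorm v ^+ 2.
  have := ler_wpM2r (enorm_ge0 v) H2; rewrite expr2; lra.
have {}H1 := ler_wpM2l (ltW (_ : 0 < N%:R^-1)) H1.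
have {}H : phi y <= phi (x + (k%:R / N%:R) *: v) + N%:R^-1 * dotv (dphi y) v by lra.
apply: le_trans H _.
apply: le_trans (lerD IHk (H1 _)) _; first by rewrite invr_gt0.
by rewrite le_eqVlt; apply/orP; left; apply/eqP; rewrite -natr1; field.
Qed.

(** At [k = N] the subdivision bound exceeds the target by exactly [c / N], which is at most [e] for
    large [N]. *)
Lemma quadratic_upper x y :
  phi y <= phi x + dotv (dphi x) (y - x) + L / 2 * enorm (y - x) ^+ 2.
Proof.
set v := y - x; set c := L / 2 * enorm v ^+ 2.
apply/ler_addgt0Pr => e e0.
have [N N0 cN] : exists2 N, (0 < N)%N & c <= e * N%:R.
  exists (Num.truncn (c / e)).+1 => //.
  by rewrite mulrC -ler_pdivrMr // ltW // truncnS_gt.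
have := quadratic_upper_subdivision x v N N0.
have N0' : 0 < N%:R :> R by rewrite ltr0n.
have NN : N%:R != 0 :> R by rewrite gt_eqF.
rewrite divff // scale1r addrC subrK mul1r => /le_trans; apply.
rewrite -!addrA lerD2l lerD2l.
rewrite (_ : _ / _ = c + c / N%:R); last by rewrite /c; field.
by rewrite lerD2l ler_pdivrMr.
Qed.

(** The point [w] minimizes the quadratic upper bound at [x] once the linear part at [y] is
    subtracted. At [w] the tangent at [y] lies below that bound, and the difference is the claim. *)
Lemma gradient_cocoercive x y :
  enorm (dphi x - dphi y) ^+ 2 <= 2 * L * (phi x - phi y - dotv (dphi y) (x - y)).
Proof.
set q := dphi x - dphi y; pose w := x - L^-1 *: q.
have := convex_ge_tangent y w; have := quadratic_upper x w.
have LL : L != 0 by rewrite gt_eqF.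
rewrite (_ : w - x = - (L^-1 *: q)); last by rewrite /w addrAC subrr add0r.
rewrite (_ : w - y = (x - y) - L^-1 *: q); last by rewrite /w addrAC.
rewrite enormN !enorm_sqr (dotvDr _ (x - y)) !(dotvNr _ (_ *: _)) !dotvZr !dotvZl.
have -> : dotv q q = dotv (dphi x) q - dotv (dphi y) q by rewrite -dotvNl -dotvDl.
set a := dotv (dphi x) q; set b := dotv (dphi y) q.
set P := phi x; set Q := phi y; set X := dotv _ (x - y) => H1 H2.
have {H1 H2} H3 := le_trans H2 H1.
have {}H3 : 0 <= P - Q - X - (a - b) / (2 * L).
  move: H3; rewrite -subr_ge0; congr (0 <= _); by field.
have := mulr_ge0 (ltW (mulr_gt0 (ltr0n _ 2) L_gt0)) H3.
rewrite mulrBr (_ : 2 * L * ((a - b) / (2 * L)) = a - b); last by field.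
lra.
Qed.

End SmoothConvex.

(** * The proximal operator: existence, three-point inequality, nonexpansiveness *)

Section Prox.
Context {R : realType} {n : nat}.
Variables (phi : 'rV[R]_n -> R) (lam Lphi : R).
Hypothesis phi_convex : convex_fun phi.
Hypothesis phi_lip : forall x y, `|phi x - phi y| <= Lphi * enorm (x - y).
Hypotheses (lam_gt0 : 0 < lam) (Lphi_ge0 : 0 <= Lphi).
Implicit Types x y z w : 'rV[R]_n.

Lemma enorm_lipschitz_continuous (psi : 'rV[R]_n -> R) (M : R) :
  (forall x y, `|psi x - psi y| <= M * enorm (x - y)) ->
  forall x, psi y @[y --> x] --> psi x.
Proof.
move=> psi_lip x; apply/(@cvgrPdist_lt _ _ _ (nbhs x)) => e e0.
pose c := `|M| * n%:R + 1.
have c0 : 0 < c by rewrite ltr_wpDl // mulr_ge0.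
near=> y.
have xy : `|x - y| < e / c.
  by near: y; apply: cvgr_dist_lt; [exact: cvg_id|rewrite divr_gt0].
apply: le_lt_trans (psi_lip x y) _.
apply: (@le_lt_trans _ _ (`|M| * (n%:R * `|x - y|))).
  apply: (@le_trans _ _ (`|M| * enorm (x - y))).
    by rewrite ler_wpM2r ?enorm_ge0 // ler_norm.
  by rewrite ler_wpM2l // enorm_le_mx_norm.
apply: (@le_lt_trans _ _ (c * `|x - y|)).
  by rewrite mulrA ler_wpM2r // /c lerDl.
by rewrite mulrC -ltr_pdivlMr.
Unshelve. all: by end_near.
Qed.

(** The continuous objective attains its minimum on a compact box around [y]; outside the box the
    centre [y] is already at least as good. *)
Lemma prox_exists y : exists z, is_prox lam phi y z.
Proof.
(* With this radius, [enorm (y - w) > r] makes half the squared distance outweigh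
   [lam * Lphi * enorm (y - w)], the largest possible decrease of [lam * phi]. *)
pose r := 2 * lam * Lphi.
have r0 : 0 <= r by rewrite !mulr_ge0 // ltW.
pose A := [set z : 'rV[R]_n | forall k, `[y ord0 k - r, y ord0 k + r]%classic (z ord0 k)].
have cA : compact A.
  apply: (@rV_compact _ _ (fun k => `[y ord0 k - r, y ord0 k + r]%classic)) => k.
  exact: segment_compact.
have Ay : A y by move=> k /=; rewrite in_itv /=; apply/andP; split; lra.
pose F z := lam * phi z + 2^-1 * enorm (y - z) ^+ 2.
have cF z : F x @[x --> z] --> F z.
  apply: (@cvgD _ _ _ (nbhs z)).
    by apply: (@cvgMr _ _ (nbhs z)); exact: enorm_lipschitz_continuous phi_lip z.
  apply: (@cvgMr _ _ (nbhs z)); rewrite expr2; under eq_fun do rewrite expr2.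
  have ce : enorm (y - x) @[x --> z] --> enorm (y - z).
    apply: (@enorm_lipschitz_continuous (fun x => enorm (y - x)) 1) => u v.
    rewrite mul1r ler_norml; apply/andP; split.
      by have := enorm_triangle u y v; have := enormB u v; lra.
    by have := enorm_triangle v y u; have := enormB u v; lra.
  exact: (@cvgM _ _ (nbhs z)).
have [z Az zmin] : exists2 z, z \in A & forall t, t \in A -> F z <= F t.
  apply: compact_EVT_min => //; first by exists y.
  exact: continuous_subspaceT.
exists z => w; rewrite -/(F z) -/(F w).
have [Aw|nAw] := pselect (A w); first by apply: zmin; rewrite inE.
apply: le_trans (zmin y _) _; first by rewrite inE.
have rw : r < enorm (y - w).
  rewrite ltNge; apply/negP => yw; apply: nAw => k /=.
  have := le_trans (coord_le_enorm (y - w) k) yw.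
  rewrite !mxE ler_norml in_itv /= => /andP[? ?]; apply/andP; split; lra.
rewrite /F subrr enorm0 expr0n mulr0 addr0.
have := phi_lip y w; rewrite ler_norml => /andP[_ yw].
have := ler_wpM2l (ltW lam_gt0) yw; rewrite /r in rw.
have := ler_wpM2r (enorm_ge0 (y - w)) (ltW rw); rewrite expr2; lra.
Qed.

(** [xget] falls back on its default [y] only when there is no minimizer, and existence rules that
    out. *)
Lemma proxP y : is_prox lam phi y (prox lam phi y).
Proof. by have [z yz] := prox_exists y; exact: (xgetI y yz). Qed.

(* Compare with the competitor [p + t (w - p)] and let t tend to 0. *)
Lemma prox_three_point y w : let p := prox lam phi y in
  lam * (phi p - phi w) <=
  2^-1 * enorm (y - w) ^+ 2 - 2^-1 * enorm (y - p) ^+ 2 - 2^-1 * enorm (p - w) ^+ 2.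
Proof.
rewrite /=; set p := prox lam phi y; rewrite -subr_le0.
apply: (le_of_forall_small_linear (b := 2^-1 * enorm (p - w) ^+ 2)) => t t0 t1.
have := proxP y (t *: w + (1 - t) *: p); rewrite -/p.
have := phi_convex w p (ltW t0) t1.
set q := phi (_ + _) => qle.
(* After division by [t], the [t * (1 - t)] term leaves the strong convexity gain
   [2^-1 * enorm (p - w) ^+ 2] and an error linear in [t]. *)
have -> : enorm (y - (t *: w + (1 - t) *: p)) ^+ 2 =
   t * enorm (y - w) ^+ 2 + (1 - t) * enorm (y - p) ^+ 2
   - t * (1 - t) * enorm (p - w) ^+ 2.
  rewrite !enorm_sqr !dotvE (dotvC p y) (dotvC w y) (dotvC w p); ring.
have := ler_wpM2l (ltW lam_gt0) qle => {}qle H.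
rewrite -(ler_pM2l t0); lra.
Qed.

(** Adding the three-point inequalities for [y] and [y'] cancels the values of [phi] and gives firm
    nonexpansiveness [H]; Cauchy-Schwarz concludes. *)
Lemma prox_nonexpansive y y' :
  enorm (prox lam phi y - prox lam phi y') <= enorm (y - y').
Proof.
set p := prox lam phi y; set p' := prox lam phi y'.
have := prox_three_point y p'; have := prox_three_point y' p.
rewrite /= -/p -/p' (enormB p' p).
move: (phi p) (phi p') => a b; move: p p' => p p' H1 H2.
have H : enorm (p - p') ^+ 2 <= dotv (y - y') (p - p').
  have {H1 H2} : 0 <= 2^-1 * (enorm (y - p') ^+ 2 - enorm (y - p) ^+ 2
    + enorm (y' - p) ^+ 2 - enorm (y' - p') ^+ 2) - enorm (p - p') ^+ 2.
    move: H1 H2; rewrite !mulrBr; move: (lam * a) (lam * b) => {}a {}b.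
    move: (enorm (y - p') ^+ 2) (enorm (y - p) ^+ 2) (enorm (y' - p) ^+ 2).
    by move: (enorm (y' - p') ^+ 2) (enorm (p - p') ^+ 2) => *; lra.
  rewrite !enorm_sqr !dotvE.
  rewrite (dotvC p y) (dotvC p' y) (dotvC p y') (dotvC p' y') (dotvC p' p).
  move: (dotv y y) (dotv y' y') (dotv p p) (dotv p' p') (dotv p p')
    (dotv y p) (dotv y p') (dotv y' p) (dotv y' p') => *; lra.
have {}H := le_trans H (dotv_le_enorm _ _).
have [pp|pp] := ltP 0 (enorm (p - p')); last exact: le_trans pp (enorm_ge0 _).
by rewrite -(ler_pM2r pp) -expr2.
Qed.

End Prox.

(** * Measurability of a continuous function of a random vector *)

Section MeasurableComposition.
Context {R : realType} {n : nat} {d : measure_display} {I : measurableType d}.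

Let grid (N : nat) (x : 'rV[R]_n) : {ffun 'I_n -> int} :=
  [ffun k => Num.floor (N.+1%:R * x ord0 k)].

Let ungrid (N : nat) (c : {ffun 'I_n -> int}) : 'rV[R]_n :=
  \row_k ((c k)%:~R / N.+1%:R).

Lemma enorm_grid N x : enorm (x - ungrid N (grid N x)) <= n%:R / N.+1%:R.
Proof.
apply: le_trans (enorm_sum_le _) _.
rewrite -[n in X in _ <= X]card_ord -sum1_card natr_sum mulr_suml.
apply: ler_sum => k _; rewrite !mxE ffunE.
have N0 : 0 < N.+1%:R :> R by rewrite ltr0n.
have := floor_le_tmp (N.+1%:R * x ord0 k).
have := floorD1_gt (N.+1%:R * x ord0 k).
set c := (Num.floor _)%:~R; set t := x ord0 k => c1 c2.
rewrite -(ler_pM2l N0) -{1}(gtr0_norm N0) -normrM mulrBr.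
have -> : N.+1%:R * (c / N.+1%:R) = c by field.
have -> : N.+1%:R * (1 / N.+1%:R) = 1 :> R by field.
by rewrite intrD1 in c1; rewrite ler_norml; apply/andP; split; lra.
Qed.

(* Rounding the vector to a grid of mesh 1/(N+1) makes it take countably many
   values; let N go to infinity. *)
Lemma measurable_comp_continuous (v : I -> 'rV[R]_n) (psi : 'rV[R]_n -> R) :
  (forall k, measurable_fun setT (fun i => v i ord0 k)) ->
  (forall x (e : R), 0 < e -> exists2 r : R, 0 < r &
     forall y, enorm (x - y) < r -> `|psi x - psi y| < e) ->
  measurable_fun setT (fun i => psi (v i)).
Proof.
move=> mv cpsi; apply/measurable_EFinP.
apply: (emeasurable_fun_cvg
  (fun N i => (psi (ungrid N (grid N (v i))))%:E)) => [N|i _].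
  apply/measurable_EFinP => _ B mB; rewrite setTI.
  rewrite [X in measurable X](_ : _ = \bigcup_(c : {ffun 'I_n -> int})
     ([set i | grid N (v i) = c] `&` [set i | B (psi (ungrid N c))])); last first.
    apply/seteqP; split => [i Bi|i [c _ [/= <-]]] //.
    by exists (grid N (v i)).
  apply: countable_bigcupT_measurable => [|c]; first exact: countableP.
  apply: measurableI; last first.
    have [Bc|nBc] := pselect (B (psi (ungrid N c))).
      by rewrite (_ : [set _ | _] = setT) //; apply/seteqP; split.
    by rewrite (_ : [set _ | _] = set0) //; apply/seteqP; split.
  (* A grid cell is a finite intersection of half-open slabs, one per coordinate. *)
  rewrite (_ : [set _ | _] = \bigcap_(k in [set: 'I_n])
     ((fun i => v i ord0 k) @^-1` `[(c k)%:~R / N.+1%:R, (c k + 1)%:~R / N.+1%:R[)).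
    by apply: fin_bigcap_measurable => // k _; rewrite -[X in measurable X]setTI; exact: mv.
  have N0 : 0 < N.+1%:R :> R by rewrite ltr0n.
  apply/seteqP; split => [i /= ic k _|i /= ic].
    move/ffunP : ic => /(_ k); rewrite ffunE /= in_itv /=.
    by rewrite ler_pdivrMr // ltr_pdivlMr // mulrC => /eqP; rewrite floor_eq.
  apply/ffunP => k; rewrite ffunE; apply/eqP; rewrite floor_eq.
  by have := ic k Logic.I; rewrite /= in_itv /= ler_pdivrMr // ltr_pdivlMr // mulrC.
apply: cvg_EFin; first by near=> N.
apply/cvgrPdist_lt => e e0 /=.
have [r r0 rP] := cpsi (v i) e e0.
near=> N; apply: rP.
apply: le_lt_trans (enorm_grid N (v i)) _.
rewrite ltr_pdivrMr // mulrC -ltr_pdivrMr //.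
apply: lt_trans (_ : N%:R < _); last by rewrite ltr_nat.
by near: N; exact: nbhs_infty_gtr.
Unshelve. all: by end_near.
Qed.

End MeasurableComposition.

(* The class on which the transition operator of the method acts: it is stable
   under that operator, contains quadratics, and makes everything integrable. *)
Definition quad_lip {R : realType} {n : nat} (phi : 'rV[R]_n -> R) : Prop :=
  exists2 M, 0 <= M &
    forall x y, `|phi x - phi y| <= M * (1 + enorm x + enorm y) * enorm (x - y).

(** * Closure, continuity and growth of the class [quad_lip] *)

Section QuadLip.
Context {R : realType} {n : nat}.
Implicit Types (phi psi : 'rV[R]_n -> R) (x y z : 'rV[R]_n).

Lemma quad_lip_cst c : quad_lip (fun _ : 'rV[R]_n => c).
Proof. by exists 0 => // x y; rewrite subrr normr0 !mul0r. Qed.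

Lemma quad_lipD phi psi : quad_lip phi -> quad_lip psi ->
  quad_lip (fun x => phi x + psi x).
Proof.
move=> [M M0 HM] [N N0 HN]; exists (M + N); first exact: addr_ge0.
move=> x y; rewrite opprD addrACA; apply: le_trans (ler_normD _ _) _.
by rewrite !mulrDl; exact: lerD.
Qed.

Lemma quad_lipZ c phi : quad_lip phi -> quad_lip (fun x => c * phi x).
Proof.
move=> [M M0 HM]; exists (`|c| * M); first exact: mulr_ge0.
by move=> x y; rewrite -mulrBr normrM -!mulrA ler_wpM2l // mulrA.
Qed.

Lemma quad_lip_sum (J : Type) (s : seq J) (F : J -> 'rV[R]_n -> R) :
  (forall j, quad_lip (F j)) -> quad_lip (fun x => \sum_(j <- s) F j x).
Proof.
move=> HF; elim: s => [|j s IHs].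
  by under eq_fun do rewrite big_nil; exact: quad_lip_cst.
by under eq_fun do rewrite big_cons; exact: quad_lipD.
Qed.

Lemma lipschitz_quad_lip phi (M : R) : 0 <= M ->
  (forall x y, `|phi x - phi y| <= M * enorm (x - y)) -> quad_lip phi.
Proof.
move=> M0 HM; exists M => // x y; apply: le_trans (HM x y) _.
rewrite ler_wpM2r ?enorm_ge0 // -{1}(mulr1 M) ler_wpM2l //.
by rewrite -addrA lerDl addr_ge0 ?enorm_ge0.
Qed.

(** A difference of squares factors as [(p - q) * (p + q)], with [|p - q| <= enorm (x - y)] and
    [p + q] of linear growth. *)
Lemma quad_lip_sqdist z : quad_lip (fun x => 2^-1 * enorm (x - z) ^+ 2).
Proof.
exists (1 + enorm z); first by rewrite addr_ge0 ?enorm_ge0.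
move=> x y; rewrite -mulrBr normrM subr_sqr normrM.
have := enorm_triangle y x z; have := enorm_triangle x y z.
have := enormD x (- z); have := enormD y (- z).
rewrite (enormB y x) (enormN z).
have := enorm_ge0 x; have := enorm_ge0 y; have := enorm_ge0 z.
have := enorm_ge0 (x - z); have := enorm_ge0 (y - z); have := enorm_ge0 (x - y).
move: (enorm x) (enorm y) (enorm z) (enorm (x - y)) => a b c e.
move: (enorm (x - z)) (enorm (y - z)) => p q *.
have -> : `|2^-1 : R| = 2^-1 by rewrite ger0_norm.
have -> : `|p + q| = p + q by rewrite ger0_norm //; lra.
have : `|p - q| <= e by rewrite ler_norml; apply/andP; split; lra.
have := normr_ge0 (p - q); move: (`|p - q|) => r r0 re.
rewrite mulrCA mulrC; apply: ler_pM; [by apply: mulr_ge0; lra|by []| |by []].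
by have := mulr_ge0 (_ : 0 <= c) (_ : 0 <= a + b); lra.
Qed.

Lemma quad_lip_continuous phi x (e : R) : quad_lip phi -> 0 < e ->
  exists2 r : R, 0 < r & forall y, enorm (x - y) < r -> `|phi x - phi y| < e.
Proof.
move=> [M M0 HM] e0; pose c := M * (2 + 2 * enorm x) + 1.
have c0 : 0 < c by rewrite ltr_wpDl // mulr_ge0 // addr_ge0 // mulr_ge0 ?enorm_ge0.
(* The cap [1] gives [enorm y <= enorm x + 1], so the local Lipschitz constant stays below [c]. *)
exists (Num.min 1 (e / c)); first by rewrite lt_min ltr01 divr_gt0.
move=> y; rewrite lt_min ltr_pdivlMr // => /andP[xy1 xye].
apply: le_lt_trans (HM x y) (le_lt_trans _ xye); rewrite mulrC.
rewrite ler_wpM2l ?enorm_ge0 // /c; apply: ler_wpDr => //; apply: ler_wpM2l => //.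
have := enorm_triangle x y 0; rewrite !subr0 (enormB y x); lra.
Qed.

Lemma quad_lip_growth phi : quad_lip phi ->
  exists2 M, 0 <= M & forall x, `|phi x| <= M * (1 + enorm x ^+ 2).
Proof.
move=> [M M0 HM]; exists (`|phi 0| + 2 * M); first by rewrite addr_ge0 // mulr_ge0.
move=> x; have := HM x 0; rewrite enorm0 subr0 addr0.
have : `|phi x| <= `|phi 0| + `|phi x - phi 0|.
  by rewrite addrC -{1}(subrK (phi 0) (phi x)) ler_normD.
have := normr_ge0 (phi 0).
move: (`|phi x|) (`|phi 0|) (`|phi x - phi 0|) (enorm x) => a b q t b0 H1 H2.
have := mulr_ge0 b0 (sqr_ge0 t).
have := mulr_ge0 M0 (sqr_ge0 (t - 1)).
have := mulr_ge0 M0 (sqr_ge0 t).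
rewrite !expr2; lra.
Qed.

End QuadLip.

(** What the operator needs from one random step: a Lipschitz constant uniform in the randomness and
    a square-integrable bound at the origin together bound the second moment of the step from any
    point. *)
Record regular_step {R : realType} {n m : nat} {d : measure_display}
    {I : measurableType d} (D : probability I R)
    (s : I -> 'I_m -> 'rV[R]_n -> 'rV[R]_n) : Prop := RegularStep {
  regular_card_gt0 : (0 < m)%N;
  regular_meas : forall j x k, measurable_fun setT (fun i => s i j x ord0 k);
  regular_lip : exists2 Ls, 0 <= Ls &
    forall i j x y, enorm (s i j x - s i j y) <= Ls * enorm (x - y);
  regular_origin : exists2 rho : I -> R,
    D.-integrable setT (fun i => (rho i ^+ 2)%:E) &
    forall i j, enorm (s i j 0) <= rho i }.

(** * The transition operator of a random step and its iterates *)

Section TransitionOperator.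
Context {R : realType} {n m : nat} {d : measure_display} {I : measurableType d}.
Variable D : probability I R.
Variable s : I -> 'I_m -> 'rV[R]_n -> 'rV[R]_n.
Hypothesis s_reg : regular_step D s.
Implicit Types (phi psi : 'rV[R]_n -> R) (x y z : 'rV[R]_n).

Definition step_avg phi (i : I) x : R := m%:R^-1 * \sum_(j < m) phi (s i j x).

(** The integral is real-valued, hence [0] when the extended-real one is infinite; on [quad_lip]
    functions it is a genuine expectation. *)
Definition transition phi x : R := (\int[D]_i step_avg phi i x)%R.

Lemma step_growth : exists Ls (rho : I -> R), [/\ 0 <= Ls,
  D.-integrable setT (fun i => (rho i ^+ 2)%:E),
  forall i j x y, enorm (s i j x - s i j y) <= Ls * enorm (x - y) &
  forall i j x, enorm (s i j x) <= rho i + Ls * enorm x].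
Proof.
have [Ls Ls0 s_lip] := regular_lip s_reg; have [rho rhoI s_rho] := regular_origin s_reg.
exists Ls, rho; split=> // i j x.
have := enorm_triangle (s i j 0) (s i j x) 0.
have := s_lip i j x 0; have := s_rho i j; rewrite !subr0; lra.
Qed.

Let m_neq0 : m%:R != 0 :> R.
Proof. by rewrite pnatr_eq0 -lt0n (regular_card_gt0 s_reg). Qed.

Lemma avg_cst (c : R) : m%:R^-1 * \sum_(j < m) c = c.
Proof. by rewrite sumr_const card_ord -[c *+ m]mulr_natl mulKf // m_neq0. Qed.

Lemma le_avg (F G : 'I_m -> R) : (forall j, F j <= G j) ->
  m%:R^-1 * \sum_(j < m) F j <= m%:R^-1 * \sum_(j < m) G j.
Proof. by move=> FG; rewrite ler_wpM2l ?invr_ge0 //; exact: ler_sum. Qed.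

(** [phi] grows at most quadratically and the step is at most [rho i + Ls * enorm x], so
    [rho i ^+ 2] dominates up to constants. *)
Lemma step_integrable phi j x : quad_lip phi ->
  D.-integrable setT (fun i => (phi (s i j x))%:E).
Proof.
move=> Qphi; have [M M0 HM] := quad_lip_growth Qphi.
have [Ls [rho [Ls_ge0 rho_int s_lip s_growth]]] := step_growth.
pose c := M * (1 + 2 * (Ls * enorm x) ^+ 2).
apply: (@le_integrable _ _ _ _ _ _ _ (fun i => (c + 2 * M * rho i ^+ 2)%:E)) => //.
- apply/measurable_EFinP; apply: measurable_comp_continuous => [k|y e e0].
    exact: regular_meas s_reg _ _ _.
  exact: quad_lip_continuous.
- move=> i _ /=; rewrite lee_fin; apply: le_trans (HM _) _.
  apply: le_trans (ler_norm _).
  have := s_growth i j x; have := enorm_ge0 (s i j x).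
  rewrite /c; move: (enorm (s i j x)) (rho i) (Ls * enorm x) => a b t a0 ab.
  rewrite (_ : _ + 2 * M * b ^+ 2 = M * (1 + 2 * t ^+ 2 + 2 * b ^+ 2)); last by ring.
  apply: ler_wpM2l => //.
  have := sqr_ge0 (b - t).
  have : a ^+ 2 <= (b + t) ^+ 2 by rewrite ler_pXn2r // nnegrE //; lra.
  rewrite !expr2; lra.
- rewrite (_ : (fun _ => _) = (EFin \o (fun=> c)) \+
     (fun i => (2 * M)%:E * (rho i ^+ 2)%:E)%E); last by [].
  apply: integrableD => //; first exact: finite_measure_integrable_cst.
  exact: integrableZl.
Qed.

Lemma step_avg_integrable phi x : quad_lip phi ->
  D.-integrable setT (EFin \o (fun i => step_avg phi i x)).
Proof.
move=> Qphi; rewrite /step_avg.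
apply: (@eq_integrable _ _ _ _ _ _
  (fun i => (m%:R^-1)%:E * \sum_(j < m) (phi (s i j x))%:E)%E) => //.
  by move=> i _; rewrite /= EFinM -sumEFin.
by apply: integrableZl => //; apply: integrable_sum => // j _; exact: step_integrable.
Qed.

Lemma Exp_cst (c : R) : (\int[D]_i c)%R = c.
Proof. rewrite Rintegral_cst // [X in fine X](_ : _ = 1%E) ?mulr1 //.
exact: probability_setT. Qed.

Lemma cst_integrable (c : R) : D.-integrable setT (EFin \o (fun _ : I => c)).
Proof. exact: finite_measure_integrable_cst. Qed.

Lemma transition_cst c x : transition (fun _ => c) x = c.
Proof.
rewrite /transition /step_avg; under eq_Rintegral do rewrite avg_cst.
exact: Exp_cst.
Qed.

Lemma transitionD phi psi x : quad_lip phi -> quad_lip psi ->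
  transition (fun y => phi y + psi y) x = transition phi x + transition psi x.
Proof.
move=> Qphi Qpsi; rewrite /transition -RintegralD //; try exact: step_avg_integrable.
by apply: eq_Rintegral => i _; rewrite /step_avg -mulrDr -big_split.
Qed.

Lemma transitionZ c phi x : quad_lip phi ->
  transition (fun y => c * phi y) x = c * transition phi x.
Proof.
move=> Qphi; rewrite /transition -RintegralZl //; last exact: step_avg_integrable.
by apply: eq_Rintegral => i _; rewrite /step_avg -mulr_sumr mulrCA.
Qed.

Lemma transition_le phi psi x : quad_lip phi -> quad_lip psi ->
  (forall y, phi y <= psi y) -> transition phi x <= transition psi x.
Proof.
move=> Qphi Qpsi le_phi; apply: le_Rintegral => //; try exact: step_avg_integrable.
by move=> i _; apply: le_avg.
Qed.

Lemma quad_lip_transition phi : quad_lip phi -> quad_lip (transition phi).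
Proof.
move=> Qphi; have [M M0 HM] := Qphi.
have [Ls [rho [Ls_ge0 rho_int s_lip s_growth]]] := step_growth.
pose E2 := (\int[D]_i (rho i ^+ 2))%R.
have E20 : 0 <= E2 by apply: Rintegral_ge0 => i _; exact: sqr_ge0.
pose N := M * Ls * (2 + E2 + Ls).
have N0 : 0 <= N by rewrite !mulr_ge0 // !addr_ge0.
exists N => //.
suff H x y : transition phi x - transition phi y <=
    N * (1 + enorm x + enorm y) * enorm (x - y).
  move=> x y; rewrite ler_norml; apply/andP; split; last exact: H.
  by have := H y x; rewrite (enormB y x) addrAC; lra.
(* The two step norms contribute [2 * rho i <= 1 + rho i ^+ 2]: the pointwise bound is then
   [c + b * rho i ^+ 2], whose expectation is [c + b * E2]. *)
pose c := M * Ls * (2 + Ls * enorm x + Ls * enorm y) * enorm (x - y).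
pose b := M * Ls * enorm (x - y).
have b0 : 0 <= b by rewrite !mulr_ge0 ?enorm_ge0.
apply: (@le_trans _ _ (c + b * E2)).
  rewrite lerBlDl /transition /E2 -RintegralZl // -{1}(Exp_cst c).
  have rI : D.-integrable setT (EFin \o (fun i => b * rho i ^+ 2)).
    apply: (@eq_integrable _ _ _ _ _ _ (fun i => b%:E * (rho i ^+ 2)%:E)%E) => //.
    exact: integrableZl.
  have cI : D.-integrable setT (EFin \o (fun i => c + b * rho i ^+ 2)).
    by apply: (@integrableD _ _ _ D setT measurableT _ _ (cst_integrable c) rI).
  rewrite -RintegralD //; last exact: cst_integrable.
  rewrite -RintegralD //; last exact: step_avg_integrable.
  apply: le_Rintegral => //; first exact: step_avg_integrable.
    by apply: (@integrableD _ _ _ D setT measurableT _ _ (step_avg_integrable _ _) cI).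
  move=> i _; rewrite /step_avg -{1}(avg_cst (c + _)) -mulrDr -big_split.
  apply: le_avg => j; rewrite -lerBlDl; apply: le_trans (ler_norm _) _.
  apply: le_trans (HM _ _) _.
  apply: (@le_trans _ _ (M * (1 + enorm (s i j x) + enorm (s i j y)) * (Ls * enorm (x - y)))).
    rewrite ler_wpM2l // mulr_ge0 // !addr_ge0 ?enorm_ge0 //.
  rewrite (_ : c + _ = M * (2 + Ls * enorm x + Ls * enorm y + rho i ^+ 2) * (Ls * enorm (x - y))).
    rewrite ler_wpM2r ?mulr_ge0 ?enorm_ge0 // ler_wpM2l //.
    have := s_growth i j x; have := s_growth i j y.
    have := sqr_ge0 (rho i - 1); rewrite !expr2; lra.
  by rewrite /c /b; ring.
rewrite /c /b /N.
rewrite (_ : _ + _ = M * Ls * enorm (x - y) * (2 + E2 + Ls * (enorm x + enorm y))); last by ring.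
rewrite (_ : M * Ls * (2 + E2 + Ls) * _ * _ =
  M * Ls * enorm (x - y) * ((2 + E2 + Ls) * (1 + (enorm x + enorm y)))); last by ring.
rewrite ler_wpM2l //.
have t0 : 0 <= enorm x + enorm y by rewrite addr_ge0 ?enorm_ge0.
have key (e t u : R) : 0 <= e -> 0 <= t -> 0 <= u -> 2 + e + u * t <= (2 + e + u) * (1 + t).
  by move=> *; nra.
exact: key.
Qed.

Lemma quad_lip_iter_transition k phi : quad_lip phi -> quad_lip (iter k transition phi).
Proof. by move=> Qphi; elim: k => //= k; exact: quad_lip_transition. Qed.

(** The left-hand side has the shape of the recursive case of [exp_gap], which is thereby turned
    into a real number. *)
Lemma transition_EFin phi x : quad_lip phi ->
  (\int[D]_i ((m%:R^-1)%:E * \sum_(j < m) (phi (s i j x))%:E))%E = (transition phi x)%:E.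
Proof.
move=> Qphi; rewrite /transition fineK; last first.
  by apply: integrable_fin_num => //; exact: step_avg_integrable.
by apply: eq_integral => i _; rewrite /step_avg EFinM -sumEFin.
Qed.

Lemma iter_transition_le k phi psi x : quad_lip phi -> quad_lip psi ->
  (forall y, phi y <= psi y) -> iter k transition phi x <= iter k transition psi x.
Proof.
move=> Qphi Qpsi le_phi; elim: k x => [|k IHk] x //=.
by apply: transition_le => //; exact: quad_lip_iter_transition.
Qed.

Lemma transition_sum (J : Type) (r : seq J) (F : J -> 'rV[R]_n -> R) x :
  (forall j, quad_lip (F j)) ->
  transition (fun y => \sum_(j <- r) F j y) x = \sum_(j <- r) transition (F j) x.
Proof.
move=> QF; elim: r => [|j r IHr].
  by under eq_fun do rewrite big_nil; rewrite big_nil transition_cst.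
under eq_fun do rewrite big_cons.
by rewrite big_cons transitionD ?IHr //; exact: quad_lip_sum.
Qed.

Lemma iter_transition_cst k c x : iter k transition (fun=> c) x = c.
Proof.
elim: k x => // k IHk x /=.
by rewrite (_ : iter k _ _ = fun=> c) ?transition_cst //; exact/funext.
Qed.

Lemma iter_transitionD k phi psi x : quad_lip phi -> quad_lip psi ->
  iter k transition (fun y => phi y + psi y) x =
  iter k transition phi x + iter k transition psi x.
Proof.
move=> Qphi Qpsi; elim: k x => // k IHk x /=.
by rewrite (funext IHk) transitionD //; exact: quad_lip_iter_transition.
Qed.

Lemma iter_transitionZ k c phi x : quad_lip phi ->
  iter k transition (fun y => c * phi y) x = c * iter k transition phi x.
Proof.
move=> Qphi; elim: k x => // k IHk x /=.
by rewrite (funext IHk) transitionZ //; exact: quad_lip_iter_transition.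
Qed.

Lemma iter_transition_sum k (J : Type) (r : seq J) (F : J -> 'rV[R]_n -> R) x :
  (forall j, quad_lip (F j)) ->
  iter k transition (fun y => \sum_(j <- r) F j y) x =
  \sum_(j <- r) iter k transition (F j) x.
Proof.
move=> QF; elim: k x => // k IHk x /=.
by rewrite (funext IHk) transition_sum // => j; exact: quad_lip_iter_transition.
Qed.

(** A telescoping Lyapunov argument with the first term of the sum split off: the remaining terms
    are [transition] of the shorter sum, to which the induction hypothesis applies pointwise, and
    the drift inequality then absorbs [a * gap x]. *)
Lemma transition_drift_sum (gap V : 'rV[R]_n -> R) (a b : R) :
  quad_lip gap -> quad_lip V -> (forall x, 0 <= V x) ->
  (forall x, transition V x + a * gap x <= V x + b) ->
  forall k x, a * \sum_(q < k.+1) iter q transition gap x <= V x + k.+1%:R * b.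
Proof.
move=> Qgap QV V0 drift; elim=> [|k IHk] x.
  rewrite big_ord1 /= mul1r; apply: le_trans (drift x); rewrite lerDr.
  by rewrite -(transition_cst 0 x); apply: transition_le => //; exact: quad_lip_cst.
have Qiter q : quad_lip (iter q transition gap) by exact: quad_lip_iter_transition.
have QS : quad_lip (fun y => \sum_(q < k.+1) iter q transition gap y).
  exact: quad_lip_sum.
rewrite big_ord_recl /= -[X in _ + X](@transition_sum _ _ (fun q : 'I_k.+1 => _)) //.
rewrite mulrDr -transitionZ //.
have := transition_le x (quad_lipZ a QS) (quad_lipD QV (quad_lip_cst (k.+1%:R * b))) IHk.
rewrite (transitionD _ QV (quad_lip_cst _)) transition_cst.
by have := drift x; rewrite -[k.+2%:R]natr1 mulrDl mul1r; lra.
Qed.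

End TransitionOperator.

(** * Harmonic sums, and the passage from averages to the last term *)

Definition harmonic_sum {R : realType} (k : nat) : R := \sum_(q < k) q.+1%:R^-1.

Section Harmonic.
Context {R : realType}.

Lemma harmonic_sumS k : harmonic_sum k.+1 = harmonic_sum k + k.+1%:R^-1 :> R.
Proof. by rewrite /harmonic_sum big_ord_recr. Qed.

Lemma harmonic_sum_ge0 k : 0 <= harmonic_sum k :> R.
Proof. by apply: sumr_ge0 => q _; rewrite invr_ge0. Qed.

(** With [a = k + 1], [1 / a <= 2 / (a + 1) <= 2 (ln (a + 1) - ln a)]. The factor 2 allows a bound
    without additive constant. *)
Lemma harmonic_sum_le_ln k : harmonic_sum k <= 2 * ln (k%:R + 1) :> R.
Proof.
elim: k => [|k IHk]; first by rewrite /harmonic_sum big_ord0 add0r ln1 mulr0.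
rewrite harmonic_sumS; apply: le_trans (lerD IHk (lexx _)) _.
rewrite natr1; have : 1 <= k.+1%:R :> R by rewrite ler1n.
move: (k.+1%:R) => a a1.
have : ln a <= ln (a + 1) - (a + 1)^-1.
  have -> : a = (a + 1) * (1 - (a + 1)^-1) by field; lra.
  have -> : (a + 1) * (1 - (a + 1)^-1) + 1 = a + 1 by field; lra.
  rewrite lnM ?posrE; [|lra|by rewrite subr_gt0 invf_lt1; lra].
  rewrite lerD2l; apply: le_trans (le_ln1Dx _) _ => //.
  by rewrite ltrN2 invf_lt1; lra.
have : a^-1 <= 2 * (a + 1)^-1.
  rewrite ler_pdivlMr; [|lra]; rewrite mulrDr mulVf; last by lra.
  have : a^-1 <= 1 by rewrite invf_le1; lra.
  lra.
lra.
Qed.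

(** Induction from [T = 1], where [3 / 2 <= 2]. The increment of the right-hand side is
    [2 (b - a) = 2 / (a + b) >= 1 / b], which exceeds the new term [1 / (b ^+ 2 + 1)]. *)
Lemma harmonic_sum_le_sqrt T : (0 < T)%N -> harmonic_sum T.+1 <= 2 * Num.sqrt T%:R :> R.
Proof.
case: T => // T _; elim: T => [|T IHT].
  by rewrite sqrtr1 !harmonic_sumS /harmonic_sum big_ord0; lra.
rewrite harmonic_sumS; apply: le_trans (lerD IHT (lexx _)) _.
have aE : Num.sqrt T.+1%:R ^+ 2 = T.+1%:R :> R by rewrite sqr_sqrtr.
have bE : Num.sqrt T.+2%:R ^+ 2 = T.+2%:R :> R by rewrite sqr_sqrtr.
have b0 : 0 <= Num.sqrt T.+2%:R :> R by exact: sqrtr_ge0.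
have a1 : 1 <= Num.sqrt T.+1%:R :> R by rewrite -{1}(sqrtr1 R) ler_sqrt // ler1n.
have key (a b c : R) : 1 <= a -> 0 <= b -> b ^+ 2 = a ^+ 2 + 1 -> c = b ^+ 2 + 1 ->
    2 * a + c^-1 <= 2 * b.
  move=> {}a1 {}b0 {}bE ->; have b1 : 1 <= b by nra.
  have ab : a <= b by rewrite -(ler_pXn2r (ltn0Sn 1)) ?nnegrE //; lra.
  have ab1 : (b - a) * (b + a) = 1 by rewrite -subr_sqr; lra.
  rewrite -lerBrDl -mulrBr -[leLHS]mul1r ler_pdivrMr; last by nra.
  nra.
by apply: key => //; rewrite bE ?aE natr1.
Qed.

End Harmonic.

(* Shamir and Zhang's passage from the average of the suffixes of a sequence
   (indexed backwards by U) to its last term. *)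
Lemma last_le_suffix_average {R : realType} (U : nat -> R) (eps B : R) (N : nat) :
  0 <= eps -> 0 <= B -> 0 <= U 0 ->
  (forall k, (k < N)%N -> (1 - eps) * \sum_(q < k.+2) U q <= k.+2%:R * (U k.+1 + B)) ->
  (1 - eps * harmonic_sum N) * U 0 <= N.+1%:R^-1 * \sum_(q < N.+1) U q + B * harmonic_sum N.
Proof.
move=> eps0 B0 U0 HU.
suff H k : (k <= N)%N ->
  (1 - eps * harmonic_sum k) * U 0 <= k.+1%:R^-1 * \sum_(q < k.+1) U q + B * harmonic_sum k.
  exact: H.
elim: k => [_|k IHk kN].
  by rewrite /harmonic_sum big_ord0 big_ord1 !mulr0 subr0 addr0 invr1.
have {IHk} := IHk (ltnW kN); have := HU k kN.
rewrite (big_ord_recr k.+1) /= harmonic_sumS -[k.+2%:R]natr1.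
have : 1 <= k.+1%:R :> R by rewrite ler1n.
have := harmonic_sum_ge0 (R := R) k.
move: (harmonic_sum k) (k.+1%:R) (\sum_(q < k.+1) U q) (U k.+1) (U 0) U0 => h c W v u u0 h0 c1.
have cN : c != 0 by lra.
have cN' : c + 1 != 0 by lra.
have c0 : 0 < c^-1 by rewrite invr_gt0; lra.
move=> H1 H2.
(* Lengthening the average by one term costs a factor [1 + eps / c] and an additive [B / c]. *)
have H3 : c^-1 * W <= (1 + eps / c) * ((c + 1)^-1 * (W + v)) + B / c.
  have := ler_wpM2l (ltW (_ : 0 < c^-1 / (c + 1))) H1.
  rewrite divr_gt0 //; last by lra.
  move=> /(_ isT) {}H1.
  have : c^-1 / (c + 1) * ((c + 1) * (v + B)) = v / c + B / c by field; apply/andP.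
  have : (1 + eps / c) * ((c + 1)^-1 * (W + v)) - c^-1 * W
    = - (c^-1 / (c + 1) * ((1 - eps) * (W + v))) + v / c
      by field; apply/andP.
  lra.
have p0 : 0 < 1 + eps / c by rewrite ltr_pwDl // divr_ge0 //; lra.
(* The new factor is absorbed because [(1 + eps / c) * (1 - eps * (h + c^-1)) <= 1 - eps * h]. *)
rewrite -(ler_pM2l p0).
apply: (@le_trans _ _ ((1 - eps * h) * u)).
  rewrite mulrA ler_wpM2r //.
  have := mulr_ge0 (mulr_ge0 eps0 h0) (divr_ge0 eps0 (_ : 0 <= c)).
  have := sqr_ge0 (eps / c); rewrite expr2; lra.
apply: (le_trans H2).
rewrite mulrDr.
have : B * (h + c^-1) <= (1 + eps / c) * (B * (h + c^-1)).
  rewrite -{1}[B * _]mul1r ler_wpM2r ?lerDl ?divr_ge0 //; last by lra.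
  by rewrite mulr_ge0 // addr_ge0 // ltW.
lra.
Qed.

(* The error term comes from maximizing the right-hand side over [enorm (p - x)]. *)
Lemma prox_gradient_step {R : realType} {n : nat} (phi : 'rV[R]_n -> R)
    (lam tau Lphi : R) (x v z : 'rV[R]_n) :
  convex_fun phi -> (forall x y, `|phi x - phi y| <= Lphi * enorm (x - y)) ->
  0 < lam -> 0 <= Lphi -> 0 <= tau ->
  2^-1 * enorm (prox lam phi (x - tau *: v) - z) ^+ 2 <=
  2^-1 * enorm (x - z) ^+ 2 - lam * (phi x - phi z) - tau * dotv v (x - z)
  + 2^-1 * (lam * Lphi + tau * enorm v) ^+ 2.
Proof.
move=> cphi lphi lam0 Lphi0 tau0.
have := prox_three_point cphi lphi lam0 Lphi0 (x - tau *: v) z; rewrite /=.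
set p := prox _ _ _.
have := ler_wpM2l (ltW lam0) (le_trans (ler_norm _) (lphi x p)).
have := ler_wpM2l tau0 (dotv_le_enorm v (x - p)).
have -> : enorm (x - tau *: v - z) ^+ 2 =
    enorm (x - z) ^+ 2 - 2 * tau * dotv v (x - z) + tau ^+ 2 * dotv v v.
  by rewrite !enorm_sqr !dotvE (dotvC x v) (dotvC z v); ring.
have -> : enorm (x - tau *: v - p) ^+ 2 =
    enorm (x - p) ^+ 2 - 2 * tau * dotv v (x - p) + tau ^+ 2 * dotv v v.
  by rewrite !enorm_sqr !dotvE (dotvC x v) (dotvC p v); ring.
have key (P X Z A B C q w e gx gp gz : R) :
   tau * P <= tau * (w * e) -> lam * (gx - gp) <= lam * (Lphi * e) ->
   lam * (gp - gz) <= 2^-1 * (A - 2 * tau * Z + C) -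
     2^-1 * (e ^+ 2 - 2 * tau * P + C) - 2^-1 * q ->
   2^-1 * q <= 2^-1 * A - lam * (gx - gz) - tau * Z + 2^-1 * (lam * Lphi + tau * w) ^+ 2.
  move=> H1 H2 H3; have := sqr_ge0 (lam * Lphi + tau * w - e).
  rewrite !expr2 in H3 *; lra.
exact: key.
Qed.

(** * Calculus of finite expectations *)

Section Expectation.
Context {R : realType} {d : measure_display} {I : measurableType d}.
Variable D : probability I R.
Implicit Types F G : I -> R.

Definition has_exp F (e : R) : Prop :=
  D.-integrable setT (EFin \o F) /\ (\int[D]_i F i)%R = e.

Lemma has_expE F e : D.-integrable setT (fun i => (F i)%:E) ->
  (\int[D]_i (F i)%:E = e%:E)%E -> has_exp F e.
Proof. by move=> intF eF; split=> //; rewrite /Rintegral eF. Qed.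

Lemma has_exp_cst c : has_exp (fun=> c) c.
Proof. by split; [exact: cst_integrable|exact: Exp_cst]. Qed.

Lemma has_expD F G a b : has_exp F a -> has_exp G b ->
  has_exp (fun i => F i + G i) (a + b).
Proof.
move=> [iF <-] [iG <-]; split; last by rewrite RintegralD.
exact: (@integrableD _ _ _ D setT measurableT _ _ iF iG).
Qed.

Lemma has_expZ c F a : has_exp F a -> has_exp (fun i => c * F i) (c * a).
Proof.
move=> [iF <-]; split; last by rewrite RintegralZl.
exact: (@integrableZl _ _ _ D setT measurableT c _ iF).
Qed.

Lemma has_expB F G a b : has_exp F a -> has_exp G b ->
  has_exp (fun i => F i - G i) (a - b).
Proof.
move=> hF hG; have := has_expD hF (has_expZ (-1) hG); rewrite mulN1r.
by under eq_fun do rewrite mulN1r.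
Qed.

Lemma has_exp_sum (J : Type) (r : seq J) (F : J -> I -> R) (a : J -> R) :
  (forall j, has_exp (F j) (a j)) ->
  has_exp (fun i => \sum_(j <- r) F j i) (\sum_(j <- r) a j).
Proof.
move=> hF; elim: r => [|j r IHr].
  by rewrite big_nil; under eq_fun do rewrite big_nil; exact: has_exp_cst.
by rewrite big_cons; under eq_fun do rewrite big_cons; exact: has_expD.
Qed.

Lemma has_exp_le F G a b : has_exp F a -> has_exp G b ->
  (forall i, F i <= G i) -> a <= b.
Proof. by move=> [iF <-] [iG <-] FG; exact: le_Rintegral. Qed.

Lemma has_exp_dotv n (V : I -> 'rV[R]_n) (u v : 'rV[R]_n) :
  (forall k, has_exp (fun i => V i ord0 k) (u ord0 k)) ->
  has_exp (fun i => dotv (V i) v) (dotv u v).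
Proof.
move=> hV; rewrite /dotv; apply: has_exp_sum => k.
by rewrite mulrC; under eq_fun do rewrite mulrC; exact: has_expZ.
Qed.

End Expectation.

(** * The randomized incremental proximal method *)

Section IncrementalProx.
Context {R : realType} {n m : nat} {d : measure_display} {I : measurableType d}.
Variables (D : probability I R).
Variables (fi : I -> 'rV[R]_n -> R) (gf : I -> 'rV[R]_n -> 'rV[R]_n).
Variables (f : 'rV[R]_n -> R) (gF : 'rV[R]_n -> 'rV[R]_n).
Variables (g : 'I_m -> 'rV[R]_n -> R) (L Lg tau sig2 : R) (xs : 'rV[R]_n).
Hypotheses (m_gt0 : (0 < m)%N) (L_gt0 : 0 < L) (Lg_ge0 : 0 <= Lg) (tau_gt0 : 0 < tau).
Hypothesis fi_convex : forall i, convex_fun (fi i).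
Hypothesis fi_grad : forall i x, differentiable (fi i) x /\
  forall v, 'd (fi i) x v = dotv (gf i x) v.
Hypothesis gf_lip : forall i x y, enorm (gf i x - gf i y) <= L * enorm (x - y).
Hypothesis gf_meas : forall x k, measurable_fun setT (fun i => gf i x ord0 k).
Hypothesis f_exp : forall x, has_exp D (fun i => fi i x) (f x).
Hypothesis gF_exp : forall x k, has_exp D (fun i => gf i x ord0 k) (gF x ord0 k).
Hypothesis g_convex : forall j, convex_fun (g j).
Hypothesis g_lip : forall j x y, `|g j x - g j y| <= Lg * enorm (x - y).
Hypothesis sig2_exp : has_exp D (fun i => enorm (gf i xs) ^+ 2) sig2.
Implicit Types x y z v : 'rV[R]_n.

Let G x := \sum_(j < m) g j x.
Let h x := f x + G x.
Hypothesis xs_min : forall x, h xs <= h x.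

Let gap x := h x - h xs.
Let lam := tau * m%:R.
Let s := rip_step gf g tau.

Let lam_gt0 : 0 < lam.
Proof. by rewrite mulr_gt0 // ltr0n. Qed.

Let nonexp j y y' : enorm (prox lam (g j) y - prox lam (g j) y') <= enorm (y - y').
Proof. exact: (prox_nonexpansive (g_convex j) (g_lip j)). Qed.

Lemma objective_quadratic_upper x y :
  f y <= f x + dotv (gF x) (y - x) + L / 2 * enorm (y - x) ^+ 2.
Proof.
have h1 := has_expD (f_exp x) (has_exp_dotv (y - x) (gF_exp x)).
have h2 := has_expD h1 (has_exp_cst D (L / 2 * enorm (y - x) ^+ 2)).
apply: has_exp_le (f_exp y) h2 _ => i.
exact: (quadratic_upper (fi_convex i) (fi_grad i) (gf_lip i)).
Qed.

Lemma convex_sum_part : convex_fun G.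
Proof.
move=> x y t t0 t1; rewrite /G !mulr_sumr -big_split.
by apply: ler_sum => j _; exact: g_convex.
Qed.

(* First-order optimality: [- gF xs] is a subgradient of [G] at [xs]. *)
Lemma bregman_le_gap x : f x - f xs - dotv (gF xs) (x - xs) <= gap x.
Proof.
rewrite /gap /h -subr_le0.
apply: (le_of_forall_small_linear (b := L / 2 * enorm (x - xs) ^+ 2)) => t t0 t1.
have := xs_min (t *: x + (1 - t) *: xs); rewrite /h.
have := convex_sum_part x xs (ltW t0) t1.
have := objective_quadratic_upper xs (t *: x + (1 - t) *: xs).
rewrite (_ : t *: x + _ - xs = t *: (x - xs)); last first.
  by apply/rowP => k; rewrite !mxE; ring.
rewrite dotvZr enormZ exprMn (ger0_norm (ltW t0)).
move: (dotv _ _) (enorm _ ^+ 2) (f _) (G _) => p e a b.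
move: (f x) (f xs) (G x) (G xs) => fx fs gx gs H1 H2 H3.
rewrite -(ler_pM2l t0); rewrite !expr2 in H1 *; lra.
Qed.

(** The tangent at [x] bounds [fi i x - fi i y] by [enorm (gf i x) * enorm (x - y)]. The gradient
    norm is compared with that at [xs], and [t <= 1 + t ^+ 2] brings in [sig2] after averaging. *)
Lemma quad_lip_objective : quad_lip f.
Proof.
pose c := 1 + sig2 + L * enorm xs + L.
have sig0 : 0 <= sig2.
  by apply: has_exp_le (has_exp_cst D 0) sig2_exp _ => i; exact: sqr_ge0.
have c0 : 0 <= c by rewrite !addr_ge0 // ?mulr_ge0 ?enorm_ge0 // ltW.
exists c => //.
suff H x y : f x - f y <= c * (1 + enorm x + enorm y) * enorm (x - y).
  move=> x y; rewrite ler_norml; apply/andP; split; last exact: H.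
  by have := H y x; rewrite (enormB y x) addrAC; lra.
have h1 := has_expD (has_exp_cst D (1 + L * enorm x + L * enorm xs)) sig2_exp.
have h2 := has_expZ (enorm (x - y)) h1.
apply: (@le_trans _ _ (enorm (x - y) * (1 + L * enorm x + L * enorm xs + sig2))).
  apply: has_exp_le (has_expB (f_exp x) (f_exp y)) h2 _ => i.
  have := convex_ge_tangent (fi_convex i) (fi_grad i) x y.
  rewrite -(opprB x y) dotvNr => H1.
  apply: (@le_trans _ _ (dotv (gf i x) (x - y))); first by lra.
  apply: le_trans (dotv_le_enorm _ _) _; rewrite mulrC ler_wpM2l ?enorm_ge0 //.
  have := enorm_triangle (gf i xs) (gf i x) 0; rewrite !subr0.
  have := gf_lip i x xs; have := enormD x (- xs); rewrite enormN => H2 H3 H4.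
  have := ler_wpM2l (ltW L_gt0) H2.
  have := sqr_ge0 (enorm (gf i xs) - 1); have := sqr_ge0 (enorm (gf i xs)).
  rewrite !expr2; lra.
rewrite mulrC ler_wpM2r ?enorm_ge0 // /c.
have key (a b e w u : R) : 0 <= a -> 0 <= b -> 0 <= e -> 0 <= w -> 0 <= u ->
    1 + u * a + w + e <= (1 + e + w + u) * (1 + a + b).
  move=> a0 b0 e0 w0 u0; have := mulr_ge0 u0 b0; have := mulr_ge0 e0 b0.
  have := mulr_ge0 w0 b0; have := mulr_ge0 e0 a0; have := mulr_ge0 w0 a0; lra.
by apply: key; rewrite ?mulr_ge0 ?enorm_ge0 // ltW.
Qed.

Lemma quad_lip_gap : quad_lip gap.
Proof.
apply: quad_lipD (quad_lip_cst _); apply: quad_lipD quad_lip_objective _.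
by apply: quad_lip_sum => j; exact: lipschitz_quad_lip Lg_ge0 (g_lip j).
Qed.

Lemma rip_step_lip i j x y : enorm (s i j x - s i j y) <= (1 + tau * L) * enorm (x - y).
Proof.
apply: le_trans (nonexp _ _ _) _.
rewrite (_ : _ - _ = (x - y) - tau *: (gf i x - gf i y)); last first.
  by apply/rowP => k; rewrite !mxE; ring.
apply: le_trans (enormD _ _) _.
rewrite enormN enormZ (gtr0_norm tau_gt0) mulrDl mul1r lerD2l -mulrA.
by rewrite ler_wpM2l // ltW.
Qed.

(** For fixed [x] and [j], the step is a Lipschitz function of the sampled gradient, whose
    coordinates are measurable. *)
Lemma rip_step_meas j x k : measurable_fun setT (fun i => s i j x ord0 k).
Proof.
apply: (@measurable_comp_continuous _ _ _ _ (fun i => gf i x)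
  (fun v => prox lam (g j) (x - tau *: v) ord0 k)) => // v e e0.
apply: quad_lip_continuous e0.
apply: (lipschitz_quad_lip (ltW tau_gt0)) => u w.
have := coord_le_enorm (prox lam (g j) (x - tau *: u) - prox lam (g j) (x - tau *: w)) k.
rewrite !mxE => /le_trans; apply; apply: le_trans (nonexp _ _ _) _.
by rewrite addrAC opprB subrKC -scalerBr enormZ gtr0_norm // enormB.
Qed.

Lemma rip_step_origin : exists2 rho : I -> R,
  D.-integrable setT (fun i => (rho i ^+ 2)%:E) & forall i j, enorm (s i j 0) <= rho i.
Proof.
pose c := tau * (L * enorm xs) + \sum_(j < m) enorm (prox lam (g j) 0).
have c_ge0 : 0 <= c.
  rewrite addr_ge0 ?sumr_ge0 // => [|l _]; last exact: enorm_ge0.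
  by rewrite !mulr_ge0 ?enorm_ge0 // ltW.
pose b i := tau * enorm (gf i xs) + c.
have b_ge0 i : 0 <= b i by rewrite addr_ge0 // mulr_ge0 ?enorm_ge0 // ltW.
pose q i := 2 * tau ^+ 2 * enorm (gf i xs) ^+ 2 + 2 * c ^+ 2.
have bq i : b i ^+ 2 <= q i.
  have key (u v : R) : (tau * u + v) ^+ 2 <= 2 * tau ^+ 2 * u ^+ 2 + 2 * v ^+ 2.
    by have := sqr_ge0 (tau * u - v); rewrite !expr2; lra.
  exact: key.
have q_ge0 i : 0 <= q i by exact: le_trans (sqr_ge0 _) (bq i).
(* The square of this bound is [q], an affine function of [enorm (gf i xs) ^+ 2] and therefore
   integrable. The sum over [j] inside [c] makes it uniform in [j]. *)
exists (fun i => Num.sqrt (q i)).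
  have [H _] := has_expD (has_expZ (2 * tau ^+ 2) sig2_exp) (has_exp_cst D (2 * c ^+ 2)).
  by apply: eq_integrable H => // i _; rewrite sqr_sqrtr.
move=> i j; apply: (@le_trans _ _ (b i)); last first.
  by rewrite -(ger0_norm (b_ge0 i)) -sqrtr_sqr ler_sqrt.
have := enorm_triangle (prox lam (g j) 0) (s i j 0) 0; rewrite !subr0.
move/le_trans; apply.
rewrite /b /c addrA; apply: lerD; last first.
  by rewrite (bigD1 j) //= lerDl sumr_ge0 // => l _; exact: enorm_ge0.
apply: le_trans (nonexp _ _ _) _.
rewrite subr0 sub0r enormN enormZ (gtr0_norm tau_gt0) -mulrDr.
rewrite ler_wpM2l ?(ltW tau_gt0) //.
have := enorm_triangle (gf i xs) (gf i 0) 0; rewrite !subr0 => /le_trans; apply.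
by rewrite addrC lerD2l; have := gf_lip i 0 xs; rewrite sub0r enormN.
Qed.

Lemma rip_step_regular : regular_step D s.
Proof.
split; [exact: m_gt0|exact: rip_step_meas| |].
- exists (1 + tau * L); last exact: rip_step_lip.
  by rewrite addr_ge0 // mulr_ge0 // ltW.
- exact: rip_step_origin.
Qed.

Lemma exp_gap_transition k x :
  exp_gap D gf g tau h (h xs) k x = (iter k (transition D s) gap x)%:E.
Proof.
elim: k x => // k IHk x.
rewrite iterS -(transition_EFin rip_step_regular); last first.
  exact: (quad_lip_iter_transition rip_step_regular _ quad_lip_gap).
by apply: eq_integral => i _; congr (_ * _)%E; apply: eq_bigr => j _; exact: IHk.
Qed.

Let K := transition D s.
Let noise := 5 * (m%:R ^+ 2 * Lg ^+ 2 + sig2).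

Lemma gradient_noise i x :
  2^-1 * (lam * Lg + tau * enorm (gf i x)) ^+ 2 <=
  tau ^+ 2 * (5 / 4 * L * (fi i x - fi i xs - dotv (gf i xs) (x - xs))
    + 5 * (m%:R ^+ 2 * Lg ^+ 2 + enorm (gf i xs) ^+ 2)).
Proof.
have := gradient_cocoercive (fi_convex i) (fi_grad i) L_gt0 (gf_lip i) x xs.
have := enorm_triangle (gf i xs) (gf i x) 0; rewrite !subr0.
have := enorm_ge0 (gf i x); have := enorm_ge0 (gf i x - gf i xs).
have := enorm_ge0 (gf i xs).
have key (v b c B a : R) : 0 <= a -> 0 <= c -> 0 <= b -> 0 <= v -> v <= b + c ->
    b ^+ 2 <= 2 * L * B -> 2^-1 * (tau * a + tau * v) ^+ 2 <=
    tau ^+ 2 * (5 / 4 * L * B + 5 * (a ^+ 2 + c ^+ 2)).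
  move=> a0 e0 b0 v0 vbc bB; rewrite -mulrDr exprMn mulrCA.
  rewrite ler_wpM2l ?sqr_ge0 //.
  have : (a + v) ^+ 2 <= (a + b + c) ^+ 2 by rewrite ler_pXn2r // ?nnegrE; lra.
  (* These squares give [(b + s) ^+ 2 <= 5 / 4 * b ^+ 2 + 5 * s ^+ 2] for [s = a + c] and
     [s ^+ 2 <= 2 * (a ^+ 2 + c ^+ 2)]. Halving, cocoercivity turns [5 / 8 * b ^+ 2] into
     [5 / 4 * L * B]. *)
  have := sqr_ge0 (b - 4 * (a + c)); have := sqr_ge0 (a - c).
  rewrite !expr2 in bB *; lra.
move=> e0 b0 v0 vbc bB; rewrite -exprMn /lam -mulrA.
by apply: key bB => //; rewrite mulr_ge0.
Qed.

Lemma rip_one_step x z :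
  K (fun y => 2^-1 * enorm (y - z) ^+ 2) x + tau * (1 - 5 / 4 * L * tau) * gap x <=
  2^-1 * enorm (x - z) ^+ 2 + tau * (gap z + tau * noise).
Proof.
pose c := 2^-1 * enorm (x - z) ^+ 2 - tau * (G x - G z).
have hK : has_exp D (fun i => step_avg s (fun y => 2^-1 * enorm (y - z) ^+ 2) i x)
    (K (fun y => 2^-1 * enorm (y - z) ^+ 2) x).
  split=> //; exact: (step_avg_integrable rip_step_regular _ (quad_lip_sqdist z)).
have hB := has_expB (has_expB (f_exp x) (f_exp xs)) (has_exp_dotv (x - xs) (gF_exp xs)).
have hN := has_expD (has_expZ (5 / 4 * L) hB)
  (has_expZ 5 (has_expD (has_exp_cst D (m%:R ^+ 2 * Lg ^+ 2)) sig2_exp)).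
have hR := has_expD (has_expB (has_exp_cst D c)
  (has_expZ tau (has_expB (f_exp x) (f_exp z)))) (has_expZ (tau ^+ 2) hN).
have {hK hB hN hR} := has_exp_le hK hR.
have step i : step_avg s (fun y => 2^-1 * enorm (y - z) ^+ 2) i x <=
   c - tau * (fi i x - fi i z) + tau ^+ 2 * (5 / 4 * L *
    (fi i x - fi i xs - dotv (gf i xs) (x - xs)) +
    5 * (m%:R ^+ 2 * Lg ^+ 2 + enorm (gf i xs) ^+ 2)).
  pose e := 2^-1 * enorm (x - z) ^+ 2 - tau * dotv (gf i x) (x - z)
    + 2^-1 * (lam * Lg + tau * enorm (gf i x)) ^+ 2.
  apply: (@le_trans _ _ (m%:R^-1 * \sum_(j < m) (e - lam * (g j x - g j z)))).
    apply: le_avg => j.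
    have := prox_gradient_step x (gf i x) z (g_convex j) (g_lip j) lam_gt0 Lg_ge0 (ltW tau_gt0).
    by rewrite /s /rip_step -/lam /e; move/le_trans; apply; rewrite -!addrA !lerD2l; lra.
  (* Averaging over the uniform index cancels the [m] in [lam = tau * m] and recovers the full sum
     [G]. *)
  have -> : m%:R^-1 * \sum_(j < m) (e - lam * (g j x - g j z)) = e - tau * (G x - G z).
    rewrite sumrB sumr_const card_ord -mulr_sumr sumrB -/(G x) -/(G z) -[e *+ m]mulr_natl.
    by rewrite /lam; field; rewrite pnatr_eq0 -lt0n.
  have key (A p S w F S' : R) : F <= p -> S <= S' ->
      A - tau * p + S - w <= A - w - tau * F + S'.
    by move=> H1 H2; have := ler_wpM2l (ltW tau_gt0) H1; lra.
  apply: key (gradient_noise i x).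
  have := convex_ge_tangent (fi_convex i) (fi_grad i) x z.
  by rewrite -(opprB x z) dotvNr; lra.
move=> /(_ step) {step}.
have p0 : 0 <= tau ^+ 2 * (5 / 4 * L) by rewrite !mulr_ge0 ?sqr_ge0 // ltW.
(* Only the mean Bregman term is compared with the gap: optimality of [xs] concerns [gF xs], not the
   individual gradients. *)
have := ler_wpM2l p0 (bregman_le_gap x); clear p0.
have key (A B C fx fs fz gx gs gz w : R) :
  tau ^+ 2 * (5 / 4 * L) * B <= tau ^+ 2 * (5 / 4 * L) * (fx + gx - (fs + gs)) ->
  A <= C - tau * (gx - gz) - tau * (fx - fz) + tau ^+ 2 * (5 / 4 * L * B + 5 * w) ->
  A + tau * (1 - 5 / 4 * L * tau) * (fx + gx - (fs + gs)) <=
  C + tau * (fz + gz - (fs + gs) + tau * (5 * w)).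
  by rewrite !expr2 => *; lra.
exact: key.
Qed.

Lemma rip_regret k x z :
  tau * (1 - 5 / 4 * L * tau) * \sum_(q < k.+1) iter q K gap x <=
  2^-1 * enorm (x - z) ^+ 2 + k.+1%:R * (tau * (gap z + tau * noise)).
Proof.
apply: (transition_drift_sum rip_step_regular quad_lip_gap (quad_lip_sqdist z)).
- by move=> y; rewrite mulr_ge0 // sqr_ge0.
- by move=> y; exact: rip_one_step.
Qed.

(** The regret bound with [z] equal to its own starting point [y] has no distance term; the monotone
    operator [K] iterated [r] times transports it. *)
Lemma rip_suffix r k x :
  (1 - 5 / 4 * L * tau) * \sum_(q < k.+1) iter (r + q) K gap x <=
  k.+1%:R * (iter r K gap x + tau * noise).
Proof.
have Q q : quad_lip (iter q K gap).
  exact: (quad_lip_iter_transition rip_step_regular _ quad_lip_gap).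
under eq_bigr do rewrite iterD.
rewrite -(iter_transition_sum rip_step_regular r _ _ (fun q : 'I_k.+1 => Q q)).
rewrite -(iter_transitionZ rip_step_regular); last by apply: quad_lip_sum => q; exact: Q.
rewrite -(iter_transition_cst rip_step_regular r (tau * noise) x).
rewrite -(iter_transitionD rip_step_regular);
  [|exact: quad_lip_gap|exact: quad_lip_cst].
rewrite -(iter_transitionZ rip_step_regular); last first.
  exact: quad_lipD quad_lip_gap (quad_lip_cst _).
apply: (iter_transition_le rip_step_regular).
- by apply: quad_lipZ; apply: quad_lip_sum => q; exact: Q.
- by apply: quad_lipZ; exact: quad_lipD quad_lip_gap (quad_lip_cst _).
move=> y; rewrite -(ler_pM2l tau_gt0) mulrA.
apply: le_trans (rip_regret k y y) _.
by rewrite subrr enorm0 expr0n mulr0 add0r mulrCA.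
Qed.

Lemma rip_gap_ge0 k x : 0 <= iter k K gap x.
Proof.
rewrite -(iter_transition_cst rip_step_regular k 0 x).
apply: (iter_transition_le rip_step_regular).
- exact: quad_lip_cst.
- exact: quad_lip_gap.
- by move=> y; rewrite subr_ge0.
Qed.

Lemma rip_last_iterate N x z : 5 / 4 * L * tau <= 1 ->
  (1 - 5 / 4 * L * tau) * ((1 - 5 / 4 * L * tau * harmonic_sum N) * iter N K gap x) <=
  N.+1%:R^-1 * (2 * tau)^-1 * enorm (x - z) ^+ 2 + gap z
  + tau * noise * (1 + harmonic_sum N).
Proof.
set eps := 5 / 4 * L * tau => eps1.
have eps0 : 0 <= eps by rewrite !mulr_ge0 // ltW.
have noise0 : 0 <= tau * noise.
  rewrite mulr_ge0 // ?(ltW tau_gt0) // mulr_ge0 // addr_ge0 //.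
    by rewrite mulr_ge0 ?sqr_ge0.
  by apply: has_exp_le (has_exp_cst D 0) sig2_exp _ => i; exact: sqr_ge0.
(* Backward indexing: [U 0] is the last expected gap, and partial sums of [U] are sums over the last
   iterates. *)
pose U q := iter (N - q) K gap x.
have sumU k : (k <= N)%N -> \sum_(q < k.+1) iter (N - k + q) K gap x = \sum_(q < k.+1) U q.
  move=> kN; rewrite (reindex_inj rev_ord_inj) /=; apply: eq_bigr => q _.
  by rewrite /U subSS addnBA ?subnK // -ltnS.
have suffix k : (k < N)%N ->
    (1 - eps) * \sum_(q < k.+2) U q <= k.+2%:R * (U k.+1 + tau * noise).
  by move=> kN; rewrite -sumU //; exact: rip_suffix.
have := last_le_suffix_average eps0 noise0 (rip_gap_ge0 _ _ : 0 <= U 0) suffix.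
have eps1' : 0 <= 1 - eps by rewrite subr_ge0.
(* The extra factor [1 - eps] matches the one in front of the full sum in [rip_regret], avoiding a
   division. *)
move=> /(ler_wpM2l eps1'); rewrite {1}/U subn0 => /le_trans; apply.
rewrite mulrDr mulrCA.
have := rip_regret N x z; rewrite -/eps -[tau * _ * _]mulrA.
have := sumU N (leqnn N); rewrite subnn => <-.
under [X in _ -> _ * (_ * X) + _ <= _]eq_bigr do rewrite add0n.
rewrite -ler_pdivlMl // => H.
have N0 : 0 <= N.+1%:R^-1 :> R by rewrite invr_ge0.
have {}H := ler_wpM2l N0 H.
have H2 : (1 - eps) * (tau * noise * harmonic_sum N) <= tau * noise * harmonic_sum N.
  by rewrite ler_piMl ?gerBl // mulr_ge0 // harmonic_sum_ge0.
apply: le_trans (lerD H H2) _.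
rewrite le_eqVlt; apply/orP; left; apply/eqP; field.
by rewrite gt_eqF //= nat1r pnatr_eq0.
Qed.

End IncrementalProx.

(** * The chosen step size and the final constants *)

Lemma last_iterate_rate {R : realType} (L D2 w W u A : R) (T : nat) :
  (0 < T)%N -> 0 < L -> 0 <= D2 -> 0 <= w -> w <= W -> 0 <= u -> 0 <= A ->
  let tau := (5 * L * Num.sqrt T%:R)^-1 in
  (1 - 5 / 4 * L * tau) * ((1 - 5 / 4 * L * tau * harmonic_sum T.+1) * u) <=
    T.+2%:R^-1 * (2 * tau)^-1 * D2 + tau * (5 * w) * (1 + harmonic_sum T.+1) ->
  u <= 10 / Num.sqrt T%:R * (L * D2 + (Num.sqrt T%:R)^-1 * A
    + W / L * (T%:R^-1 + 4 * ln (T%:R + 1))).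
Proof.
move=> T0 L0 D20 w0 wW u0 A0.
have TE : Num.sqrt T%:R ^+ 2 = T%:R :> R by rewrite sqr_sqrtr.
have r1 : 1 <= Num.sqrt T%:R :> R by rewrite -{1}(sqrtr1 R) ler_sqrt // ler1n.
have H0 := harmonic_sum_ge0 (R := R) T.+1.
have Hr := harmonic_sum_le_sqrt (R := R) T0.
(* Splitting off the last term, at most [1 / 2], keeps [T + 1] as the argument of the logarithm. *)
have Hln : harmonic_sum T.+1 <= 2 * ln (T%:R + 1) + 2^-1 :> R.
  rewrite harmonic_sumS; apply: lerD (harmonic_sum_le_ln _) _.
  by rewrite lef_pV2 ?posrE // ler_nat ltnS.
(* Since [harmonic_sum T >= 1], additive constants can be absorbed into the logarithm. *)
have ln1 : 1 <= 2 * ln (T%:R + 1) :> R.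
  apply: le_trans (harmonic_sum_le_ln T); case: (T) T0 => // T' _.
  by rewrite /harmonic_sum big_ord_recl invr1 lerDl sumr_ge0.
have -> : T.+2%:R = Num.sqrt T%:R ^+ 2 + 2 :> R by rewrite TE -addn2 natrD.
have t0 : 0 <= T%:R^-1 :> R by rewrite invr_ge0.
move: (T%:R^-1) t0 (Num.sqrt T%:R) r1 (harmonic_sum T.+1) H0 Hr (ln _) Hln ln1.
move=> t t0 r r1 H H0 Hr l Hl l1 tau.
have r0 : r != 0 by lra.
have L0' : L != 0 by lra.
have epsE : 5 / 4 * L * tau = (4 * r)^-1 by rewrite /tau; field; rewrite r0 L0'.
rewrite epsE.
have -> : tau * (5 * w) = w / (L * r) by rewrite /tau; field; rewrite r0 L0'.
have -> : (2 * tau)^-1 = 5 * L * r / 2 by rewrite /tau; field; rewrite r0 L0'.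
have e0 : 0 < (4 * r)^-1 by rewrite invr_gt0; lra.
have e1 : (4 * r)^-1 <= 4^-1 by rewrite lef_pV2 ?posrE; lra.
have eH : (4 * r)^-1 * H <= 2^-1.
  by rewrite mulrC ler_pdivrMr; lra.
move=> main.
(* From [eps <= 1 / 4] and [eps * H <= 1 / 2], the two factors multiply to at least
   [3 / 4 * 1 / 2]. *)
have lhs : 3 / 8 * u <= (1 - (4 * r)^-1) * ((1 - (4 * r)^-1 * H) * u).
  rewrite mulrA ler_wpM2r //; move: ((4 * r)^-1) ((4 * r)^-1 * H) e1 eH => a b a1 b1.
  have := mulr_ge0 (_ : 0 <= 4^-1 - a) (_ : 0 <= 2^-1 - b); nra.
have {main}main := le_trans lhs main.
have dist : (r ^+ 2 + 2)^-1 * (5 * L * r / 2) * D2 <= 5 / 2 * (L * D2 / r).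
  rewrite [leLHS](_ : _ = 5 / 2 * (L * D2) * (r / (r ^+ 2 + 2))); last by field; nra.
  rewrite [leRHS]mulrA ler_wpM2l //; first by rewrite mulr_ge0 // mulr_ge0 // ltW.
  rewrite ler_pdivrMr; last by nra.
  by rewrite mulrDr expr2 mulKf // lerDl mulr_ge0 // invr_ge0; lra.
have Lr0 : 0 < L * r by nra.
have nz : w / (L * r) * (1 + H) <= W / (L * r) * (5 * l).
  apply: ler_pM; [by rewrite divr_ge0 // ltW|lra| |lra].
  by rewrite ler_wpM2r // invr_ge0 ltW.
have -> : 10 / r * (L * D2 + r^-1 * A + W / L * (t + 4 * l)) =
  10 * (L * D2 / r) + 10 * (r^-1 * (r^-1 * A)) + 10 * (W / (L * r) * t) + 40 * (W / (L * r) * l).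
  by field; rewrite r0 L0'.
have W0 : 0 <= W by exact: le_trans wW.
have a1 : 0 <= r^-1 * (r^-1 * A) by rewrite !mulr_ge0 // invr_ge0; lra.
have WLr : 0 <= W / (L * r) by rewrite divr_ge0 // ltW.
have a2 : 0 <= W / (L * r) * t by rewrite mulr_ge0.
have a3 : 0 <= W / (L * r) * l by rewrite mulr_ge0 //; lra.
have a4 : 0 <= L * D2 / r by rewrite divr_ge0 // ?mulr_ge0 // ?ltW //; lra.
rewrite (mulrCA _ 5) in nz.
(* Multiplying by [8 / 3] gives coefficients [20 / 3 <= 10] for the distance and [40 / 3 <= 40] for
   the logarithm. *)
move: main dist nz a1 a2 a3 a4; clear.
move: (_ * _ * D2) (w / _ * _) (W / _ * l) (W / _ * t) (r^-1 * _) (L * D2 / r) => *; lra.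
Qed.

Theorem theorem4p1
  (R : realType) (n m : nat) (d : measure_display) (I : measurableType d)
  (D : probability I R)
  (fi : I -> 'rV[R]_n -> R) (gf : I -> 'rV[R]_n -> 'rV[R]_n)
  (f : 'rV[R]_n -> R) (gF : 'rV[R]_n -> 'rV[R]_n)
  (g : 'I_m -> 'rV[R]_n -> R)
  (L Lg : R) (xs x0 : 'rV[R]_n) (D2 sig2 : R) (T : nat) :
  (0 < m)%N ->
  0 < L -> 0 <= Lg ->
  (* each f_i convex, differentiable with gradient gf i, L-Lipschitz gradient *)
  (forall i, convex_fun (fi i)) ->
  (forall i x, differentiable (fi i) x /\
     forall v, 'd (fi i) x v = dotv (gf i x) v) ->
  (forall i x y, enorm (gf i x - gf i y) <= L * enorm (x - y)) ->
  (* measurability in the random index *)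
  (forall x (k : 'I_n), measurable_fun setT (fun i => gf i x ord0 k)) ->
  (* f = E_i f_i *)
  (forall x, D.-integrable setT (fun i => (fi i x)%:E) /\
     (\int[D]_i (fi i x)%:E = (f x)%:E)%E) ->
  (* f differentiable with gradient gF, and E_i grad f_i = grad f *)
  (forall x, differentiable f x /\ forall v, 'd f x v = dotv (gF x) v) ->
  (forall x (k : 'I_n), D.-integrable setT (fun i => (gf i x ord0 k)%:E) /\
     (\int[D]_i (gf i x ord0 k)%:E = (gF x ord0 k)%:E)%E) ->
  (* each g_j convex and Lg-Lipschitz (hence proper, lsc) *)
  (forall j, convex_fun (g j)) ->
  (forall j x y, `|g j x - g j y| <= Lg * enorm (x - y)) ->
  (* xs is a minimizer of h = f + sum_j g_j *)
  (forall x, f xs + \sum_(j < m) g j xs <= f x + \sum_(j < m) g j x) ->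
  (* D2 = min over the minimizers x* of ||x* - x0||^2 *)
  (exists2 xm, (forall x, f xm + \sum_(j < m) g j xm <= f x + \sum_(j < m) g j x)
     & enorm (xm - x0) ^+ 2 = D2) ->
  (forall xm, (forall x, f xm + \sum_(j < m) g j xm <= f x + \sum_(j < m) g j x) ->
     D2 <= enorm (xm - x0) ^+ 2) ->
  (* sigma_*^2 = E_i ||grad f_i(xs)||^2 < oo *)
  (\int[D]_i ((enorm (gf i xs)) ^+ 2)%:E = sig2%:E)%E ->
  (1 <= T)%N ->
  let h := fun x => f x + \sum_(j < m) g j x in
  let hstar := h xs in
  let tau := (5 * L * Num.sqrt T%:R)^-1 in
  (exp_gap D gf g tau h hstar T.+1 x0 <=
    (10 / Num.sqrt T%:R *
      (L * D2 + (Num.sqrt T%:R)^-1 * (h x0 - hstar)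
       + (sig2 + 4 * m%:R ^+ 2 * Lg ^+ 2) / L * ((T%:R)^-1 + 4 * ln (T%:R + 1))))%:E)%E.
Proof.
move=> m0 L0 Lg0 fi_convex fi_grad gf_lip gf_meas f_exp _ gF_exp g_convex g_lip.
move=> xs_min [xm xm_min xmD] _ sigE T1; cbv zeta.
set tau := _^-1; set h := fun x => _ + _.
have tau0 : 0 < tau.
  by rewrite invr_gt0 !mulr_gt0 // sqrtr_gt0 ltr0n.
have {}f_exp x : has_exp D (fun i => fi i x) (f x).
  by have [? ?] := f_exp x; exact: has_expE.
have {}gF_exp x k : has_exp D (fun i => gf i x ord0 k) (gF x ord0 k).
  by have [? ?] := gF_exp x k; exact: has_expE.
have sig2_exp : has_exp D (fun i => enorm (gf i xs) ^+ 2) sig2.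
  apply: has_expE => //; apply/integrableP; split.
    apply/measurable_EFinP; under eq_fun do rewrite enorm_sqr.
    by apply: measurable_sum => k; exact: measurable_funM.
  under eq_integral do rewrite gee0_abs ?lee_fin ?sqr_ge0 //.
  by rewrite sigE ltry.
(* The distance is attained at [xm] while the variance is taken at [xs]; both being minimizers, [xm]
   can serve as [z] with zero gap. *)
have xm_gap : h xm - h xs = 0.
  by apply/eqP; rewrite subr_eq0 eq_le; apply/andP; split; [exact: xm_min|exact: xs_min].
rewrite (exp_gap_transition m0 L0 Lg0 tau0 fi_convex fi_grad gf_lip gf_meas f_exp g_convex
  g_lip sig2_exp) lee_fin.
have tau_small : 5 / 4 * L * tau <= 1.
  have r1 : 1 <= Num.sqrt T%:R :> R by rewrite -{1}(sqrtr1 R) ler_sqrt // ler1n.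
  rewrite /tau ler_pdivrMr ?mul1r; last by rewrite -invr_gt0.
  by have := ler_wpM2l (ltW L0) r1; lra.
have := rip_last_iterate m0 L0 Lg0 tau0 fi_convex fi_grad gf_lip gf_meas f_exp gF_exp
  g_convex g_lip sig2_exp xs_min T.+1 x0 xm tau_small.
rewrite -/(h xm) -/(h xs) xm_gap addr0 enormB xmD => last_iterate.
have sig0 : 0 <= sig2.
  by apply: has_exp_le (has_exp_cst D 0) sig2_exp _ => i; exact: sqr_ge0.
have mLg0 : 0 <= m%:R ^+ 2 * Lg ^+ 2 by rewrite mulr_ge0 ?sqr_ge0.
apply: last_iterate_rate last_iterate => //.
- by rewrite -xmD sqr_ge0.
- exact: addr_ge0.
- by lra.
- exact: (rip_gap_ge0 m0 L0 Lg0 tau0 fi_convex fi_grad gf_lip gf_meas f_exp g_convex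
    g_lip sig2_exp xs_min).
- by rewrite subr_ge0; exact: xs_min.
Qed.
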